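(* If an ideal $I$ is soft-edged or soft-complemented and it is invariant under $\mathscr C$, then $I$ is am-closed.
   Context: $\mathrm{c}_{\mathrm{o}}^*$ denotes the cone of nonnegative monotone nonincreasing sequences converging to $0$ (not a dual space). $H$ is a complex separable infinite-dimensional Hilbert space. An ideal is a two-sided ideal of $B(H)$ contained in the compact operators. $s(X)$ is the nonincreasing sequence of singular numbers of a compact operator $X$ (with multiplicity, with infinitely many zeros added if $X$ has finite rank). The characteristic set of $I$ is $\Sigma(I):=\{s(X)\mid X\in I\}\subset \mathrm{c}_{\mathrm{o}}^*$; it determines $I$ (Calkin). For $\xi\in \mathrm{c}_{\mathrm{o}}^*$, $\xi_a:=\langle\frac1n\sum_{j=1}^n\xi_j\rangle$. The ideals ${}_aI$ and $I_a$ have characteristic sets $\Sigma({}_aI)=\{\xi\in \mathrm{c}_{\mathrm{o}}^*\mid\xi_a\in\Sigma(I)\}$ and $\Sigma(I_a)=\{\xi\in \mathrm{c}_{\mathrm{o}}^*\mid\xi=O(\eta_a)\text{ for some }\eta\in\Sigma(I)\}$, where $\xi=O(\zeta)$ means $\xi_n\le M\zeta_n$ for some $M>0$ and all $n$. The am-closure of $I$ is $I^-:={}_a(I_a)$, and $I$ is am-closed if $I=I^-$. With products of sequences taken entrywise and $\xi$ ranging over $\mathrm{c}_{\mathrm{o}}^*$: $I$ is soft-edged if $\xi\in\Sigma(I)$ if and only if $\xi=\alpha\eta$ for some $\alpha\in \mathrm{c}_{\mathrm{o}}^*$ and some $\eta\in\Sigma(I)$; $I$ is soft-complemented if $\xi\in\Sigma(I)$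 if and only if $\alpha\xi\in\Sigma(I)$ for all $\alpha\in \mathrm{c}_{\mathrm{o}}^*$. $\mathscr C:=\{\sum_{j=1}^\infty t_j\Pi_j\mid\Pi_j\text{ an (infinite) permutation matrix},\ 0<t_j\le1,\ \sum_{j=1}^\infty t_j=1\}$. For $P\in\mathscr C$ and $\xi\in \mathrm{c}_{\mathrm{o}}^*$, $P\xi:=\langle\sum_jP_{ij}\xi_j\rangle_i$ and $(P\xi)^*$ is its monotone nonincreasing rearrangement. $I$ is invariant under $\mathscr C$ if $(P\xi)^*\in\Sigma(I)$ for every $P\in\mathscr C$ and every $\xi\in\Sigma(I)$. *)

(* Defs.v *)
From HB Require Import structures.
From mathcomp Require Import all_boot all_order all_algebra.
From mathcomp Require Import all_classical all_reals all_analysis.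
From mathcomp Require Export sesquilinear complex.

Set Implicit Arguments.
Unset Strict Implicit.
Unset Printing Implicit Defensive.

Import Order.TTheory GRing.Theory Num.Theory Num.Def.
Import numFieldNormedType.Exports.

Local Open Scope classical_set_scope.
Local Open Scope ring_scope.
Local Open Scope complex_scope.

(** Sequences are indexed from 0: [xi n] is the (n+1)-st term of the sequence
    [xi]. *)
Section Sequences.
Variable R : realType.
Implicit Types (xi eta z : nat -> R) (S : set (nat -> R)).

Definition c0star xi : Prop :=
  [/\ forall n, 0 <= xi n, nonincreasing_seq xi & xi @ \oo --> (0 : R)].

Definition amean xi : nat -> R :=
  fun n => n.+1%:R^-1 * \sum_(j < n.+1) xi j.

Definition bigO_seq xi eta : Prop :=
  exists2 M : R, 0 < M & forall n, xi n <= M * eta n.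

(** The characteristic sets of the ideals [_a I] and [I_a], where [S] is the
    characteristic set of [I]. *)
Definition pre_am_seqs S : set (nat -> R) :=
  [set xi | c0star xi /\ S (amean xi)].

Definition am_seqs S : set (nat -> R) :=
  [set xi | c0star xi /\ exists2 eta, S eta & bigO_seq xi (amean eta)].

Definition soft_edged_seqs S : Prop :=
  forall xi, c0star xi ->
    (S xi <-> exists alpha eta,
                [/\ c0star alpha, S eta & xi = (fun n => alpha n * eta n)]).

Definition soft_complemented_seqs S : Prop :=
  forall xi, c0star xi ->
    (S xi <-> forall alpha, c0star alpha -> S (fun n => alpha n * xi n)).

(** Infinite matrices are functions [nat -> nat -> R]. *)
Definition perm_matrix (P : nat -> nat -> R) : Prop :=
  exists2 s : nat -> nat, bijective s & forall i j, P i j = (s i == j)%:R.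

(** The sum of the [t k *: Pi k] is taken entrywise. *)
Definition infinite_perm_combination (P : nat -> nat -> R) : Prop :=
  exists (t : nat -> R) (Pi : nat -> nat -> nat -> R),
    [/\ forall k, perm_matrix (Pi k),
        forall k, 0 < t k <= 1,
        series t @ \oo --> (1 : R) &
        forall i j, series (fun k => t k * Pi k i j) @ \oo --> P i j].

Definition matrix_apply (P : nat -> nat -> R) xi : nat -> R :=
  fun i => limn (series (fun j => P i j * xi j)).

(** [z] is the monotone nonincreasing rearrangement of the nonnegative null
    sequence [xi].  Only the positive terms are matched: if infinitely many
    terms of [xi] are positive then the null terms of [xi] do not occur
    in [z]. *)
Definition monotone_rearrangement xi z : Prop :=
  c0star z /\
  exists2 f : nat -> nat,
    set_bij [set i | 0 < xi i] [set n | 0 < z n] f &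
    forall i, 0 < xi i -> z (f i) = xi i.

Definition perm_invariant_seqs S : Prop :=
  forall P xi, infinite_perm_combination P -> S xi ->
    exists2 z, monotone_rearrangement (matrix_apply P xi) z & S z.

End Sequences.

(** A complex Hilbert space is a complete normed space over [R[i]] whose norm
    is induced by a positive definite Hermitian form [dot], linear in its first
    argument. *)
Section Operators.
Variables (R : realType) (H : completeNormedModType R[i]).
Implicit Types (T X A : H -> H) (I J : set (H -> H)).

Definition separable_space : Prop :=
  exists2 D : set H, countable D & dense D.

Definition infinite_dimensional : Prop :=
  forall (n : nat) (b : 'I_n -> H),
    ~ (forall x : H, exists c : 'I_n -> R[i], x = \sum_(i < n) c i *: b i).

Definition bounded_operator T : Prop := linear T /\ continuous T.

Definition compact_operator T : Prop :=
  linear T /\ precompact (T @` [set x | `|x| <= 1]).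

Record is_ideal I : Prop := IsIdeal {
  ideal_compact : forall X, I X -> compact_operator X;
  ideal0 : I (fun=> 0);
  idealD : forall X Y, I X -> I Y -> I (X \+ Y);
  idealMl : forall T X, bounded_operator T -> I X -> I (T \o X);
  idealMr : forall T X, bounded_operator T -> I X -> I (X \o T)
}.

Variable dot : {dot H for (@conjC R[i])}.

Definition is_adjoint X A : Prop :=
  bounded_operator A /\ forall x y, dot (X x) y = dot x (A y).

(** The positive terms of [s] are the square roots of the nonzero eigenvalues
    of [X^* X] (that is, the nonzero eigenvalues of [|X|]), repeated according
    to multiplicity: for every [l > 0], the [e n] with [s n = l] form an
    orthonormal basis of the kernel of [X^* X - l ^ 2].  If [X] has finite
    rank then the remaining terms of [s] are 0. *)
Definition singular_numbers X (s : nat -> R) : Prop :=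
  c0star s /\
  exists (A : H -> H) (e : nat -> H),
    is_adjoint X A /\
    forall l : R, 0 < l ->
      (forall m n, s m = l -> s n = l -> dot (e m) (e n) = (m == n)%:R) /\
      (forall v : H, A (X v) = (l ^+ 2)%:C *: v <->
        exists (N : nat) (c : nat -> R[i]),
          v = \sum_(n < N | s n == l) c n *: e n).

Definition char_set I : set (nat -> R) :=
  [set s | exists2 X, I X & singular_numbers X s].

(** The ideal with a prescribed characteristic set (Calkin's correspondence). *)
Definition ideal_of_char_set (S : set (nat -> R)) : set (H -> H) :=
  [set X | compact_operator X /\ exists2 s, S s & singular_numbers X s].

Definition pre_am_ideal I := ideal_of_char_set (pre_am_seqs (char_set I)).

Definition am_ideal I := ideal_of_char_set (am_seqs (char_set I)).

Definition am_closure I := pre_am_ideal (am_ideal I).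

Definition am_closed I : Prop := I = am_closure I.

Definition soft_edged I : Prop := soft_edged_seqs (char_set I).

Definition soft_complemented I : Prop := soft_complemented_seqs (char_set I).

Definition perm_invariant I : Prop := perm_invariant_seqs (char_set I).

End Operators.

(* Main.v *)
Require Import Defs.
From mathcomp Require Import all_boot all_order all_algebra.
From mathcomp Require Import all_classical all_reals all_analysis.
From mathcomp Require Import ring lra zify.
Import Order.TTheory GRing.Theory Num.Theory Num.Def.
Import numFieldNormedType.Exports ComplexField.Normc.
Local Open Scope classical_set_scope.
Local Open Scope ring_scope.

(** Let [S] be the characteristic set of [I], and let [xi] be such that
    [amean xi <= M * amean eta] with [eta] in [S], that is, [xi] is weakly
    majorized by [M * eta].  On any finite block of indices, a weakly majorized
    sequence lies below a convex combination of permutations of the majorizing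
    one.  An element of the class C averages countably many permutations, so
    it can serve infinitely many successive blocks, giving weight [2 ^- k] to
    the [k]-th one; the price is that [2 ^ k * xi] must be majorized by [eta]
    on the [k]-th block.  This holds for [alpha * xi] instead of [xi] for every
    null sequence [alpha] (the blocks are chosen after [alpha]), which settles
    the soft-complemented case, and it holds for [xi] itself if
    [eta = alpha * eta'] with [eta'] in [S], which settles the soft-edged case.

    The passage between ideals and sequences rests on the Schmidt decomposition
    [X = \sum_n s_n <., e_n> f_n] of a compact operator, on the uniqueness of
    the singular numbers, and on the factorization [X = W Z V] with bounded [V]
    and [W] if the singular numbers of [X] are dominated by those of [Z]. *)

Set Implicit Arguments.
Unset Strict Implicit.
Unset Printing Implicit Defensive.

(* [complex_scope] stays closed until the theorem: it would turn the
   conjugation [^*] of [numClosedFieldType] into [conjc]. *)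
Local Notation "x %:C" := (real_complex _ x) : ring_scope.

(** * Finite and infinite majorization *)

Section PermutationHull.
Variable R : realType.
Implicit Types (x y u v w : nat -> R) (t : R).

(** The convex hull of the rearrangements of [y]. Binary combinations suit inductive proofs;
    [perm_hull_sum] flattens them into one finite mean. *)
Inductive perm_hull y : (nat -> R) -> Prop :=
| perm_hull_perm s : bijective s -> perm_hull y (y \o s)
| perm_hull_conv t u v : 0 <= t <= 1 -> perm_hull y u -> perm_hull y v ->
    perm_hull y (fun i => t * u i + (1 - t) * v i).

Lemma perm_hull_refl y : perm_hull y y.
Proof. by have := @perm_hull_perm y id; apply; exists id. Qed.

Lemma perm_hull_comp y w s : bijective s -> perm_hull y w ->
  perm_hull y (w \o s).
Proof.
move=> bs; elim=> [s' bs'|t u v t01 _ hu _ hv].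
  have := @perm_hull_perm y (s' \o s); apply; exact: bij_comp.
exact: (perm_hull_conv t01 hu hv).
Qed.

Lemma perm_hull_trans y w v : perm_hull y w -> perm_hull w v -> perm_hull y v.
Proof.
move=> yw; elim=> [s bs|t u1 u2 t01 _ h1 _ h2]; first exact: perm_hull_comp.
exact: perm_hull_conv.
Qed.

Definition scons (a : R) y : nat -> R := fun i => if i is j.+1 then y j else a.

Lemma perm_hull_cons a y v : perm_hull y v ->
  perm_hull (scons a y) (scons a v).
Proof.
elim=> [s [s' sK s'K]|t u1 u2 t01 _ h1 _ h2].
  pose ext (s : nat -> nat) i := if i is j.+1 then (s j).+1 else 0%N.
  have -> : scons a (y \o s) = scons a y \o ext s by apply/funext => -[|i].
  apply: perm_hull_perm; exists (ext s') => -[|i] //=.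
    by rewrite sK.
  by rewrite s'K.
have -> : scons a (fun i => t * u1 i + (1 - t) * u2 i)
    = (fun i => t * scons a u1 i + (1 - t) * scons a u2 i).
  by apply/funext => -[|i] //=; ring.
exact: perm_hull_conv.
Qed.

(** The cycle that brings index [k] to the front and keeps the order of the others, which [bump k]
    enumerates. *)
Definition rot_to0 k i : nat := if i is j.+1 then bump k j else k.

Lemma rot_to0_bij k : bijective (rot_to0 k).
Proof.
exists (fun j => if j == k then 0%N else (unbump k j).+1) => [[|i]|j] /=.
- by rewrite eqxx.
- by rewrite eq_sym (negbTE (neq_bump _ _)) bumpK.
- by case: eqVneq => [->//|jk] /=; rewrite unbumpK.
Qed.

Definition swapn k i : nat :=
  if i == k then k.+1 else if i == k.+1 then k else i.

Lemma swapn_bij k : bijective (swapn k).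
Proof.
exists (swapn k) => i; rewrite /swapn; case: (eqVneq i k) => [->|ik];
  rewrite ?eqxx ?(gtn_eqF (ltnSn k)) //; case: (eqVneq i k.+1) => [->|ik1];
  by rewrite ?eqxx // (negbTE ik) (negbTE ik1).
Qed.

(* Hardy-Littlewood-Polya: transfer mass between the two consecutive terms of
   [y] that surround [x 0], so that one of them becomes [x 0], then move that
   term to the front and go on with the remaining terms. *)
Lemma majorized_perm_hull L x y :
  nonincreasing_seq x -> nonincreasing_seq y ->
  (forall m, (m <= L)%N -> \sum_(i < m) x i <= \sum_(i < m) y i) ->
  exists2 w, perm_hull y w & forall i, (i < L)%N -> x i <= w i.
Proof.
elim: L x y => [|L IHL] x y xd yd xy.
  by exists y => //; exact: perm_hull_refl.
have x0y0 : x 0%N <= y 0%N by have := xy 1%N isT; rewrite !big_ord1.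
(* Let [k] be the last index up to [L] with [x 0 <= y k]. If [k = L], then [y] itself dominates [x]
   as far as needed; otherwise [y k.+1 < x 0 <= y k]. *)
pose Q k := (k <= L)%N && (x 0%N <= y k).
have exQ : exists k, Q k by exists 0%N; rewrite /Q x0y0.
have bQ k : Q k -> (k <= L)%N by case/andP.
case: (ex_maxnP exQ bQ) => k /andP[kL xk] kmax.
have xyk i : (i <= k)%N -> x 0%N <= y i.
  by move=> ik; apply: (le_trans xk); exact: yd.
have [kL'|kL'] := leqP L k.
  exists y; first exact: perm_hull_refl.
  move=> i iL; apply: (@le_trans _ _ (x 0%N)); first exact: xd.
  by apply: xyk; lia.
have yk1 : y k.+1 < x 0%N.
  rewrite ltNge; apply/negP => h; have := kmax k.+1; rewrite /Q h kL'/=; lia.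
(* This weight gives the mean of [y] and its transposed copy the value [x 0] at [k]; place [k.+1]
   keeps the remaining mass [y k + y k.+1 - x 0]. *)
pose t := (x 0%N - y k.+1) / (y k - y k.+1).
have dgt0 : 0 < y k - y k.+1 by lra.
have t01 : 0 <= t <= 1.
  rewrite divr_ge0 /=; [|lra|lra]; rewrite ler_pdivrMr //; lra.
pose w i := t * y i + (1 - t) * y (swapn k i).
have yw : perm_hull y w.
  apply: (perm_hull_conv t01); first exact: perm_hull_refl.
  exact: (perm_hull_perm y (swapn_bij k)).
have wk : w k = x 0%N.
  by rewrite /w /swapn eqxx /t; field; rewrite gt_eqF.
have wk1 : w k.+1 = y k + y k.+1 - x 0%N.
  rewrite /w /swapn eqxx (gtn_eqF (ltnSn k)).
  by rewrite /t; field; rewrite gt_eqF.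
have wi i : i != k -> i != k.+1 -> w i = y i.
  by move=> ik ik1; rewrite /w /swapn (negbTE ik) (negbTE ik1); ring.
(* [y'] is [w] without its term [x 0]. It is still nonincreasing, since the new term lies between
   [y k.+1] and [y k]. *)
pose y' i := w (bump k i).
have y'lt i : (i < k)%N -> y' i = y i.
  by move=> ik; rewrite /y' /bump leqNgt ik /= add0n wi //; lia.
have y'k : y' k = y k + y k.+1 - x 0%N by rewrite /y' /bump leqnn.
have y'gt i : (k < i)%N -> y' i = y i.+1.
  by move=> ki; rewrite /y' /bump (ltnW ki) /= add1n wi //; lia.
have sumy' m : \sum_(i < m) y' i =
    if (m <= k)%N then \sum_(i < m) y i else \sum_(i < m.+1) y i - x 0%N.
  elim: m => [|m IHm]; first by rewrite !big_ord0.
  rewrite big_ord_recr /= {}IHm; case: (ltngtP m k) => mk.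
  - by rewrite big_ord_recr /= y'lt.
  - by rewrite [in RHS]big_ord_recr /= y'gt //; lra.
  - by rewrite mk !big_ord_recr /= y'k; lra.
have [w' hw' xw'] : exists2 w', perm_hull y' w' &
    forall i, (i < L)%N -> (x \o S) i <= w' i.
  apply: IHL.
  - by move=> i j ij; apply: xd.
  - apply/nonincreasing_seqP => i; have := yd i i.+1 (leqnSn i).
    have := yd i.+1 i.+2 (leqnSn _).
    case: (ltngtP i.+1 k) => ik h1 h2.
    + by rewrite !y'lt //; lia.
    + case: (ltngtP i k) => ik'; [lia| |].
        by rewrite !y'gt //; lia.
      by rewrite ik' y'k y'gt //; rewrite ik' in h1 h2; lra.
    + by rewrite ik in h1 h2 *; rewrite y'k y'lt; [lra|lia].
  (* Up to [k] the terms of [y] are at least [x 0], hence at least those of [x]; beyond [k] both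
     partial sums have lost exactly [x 0]. *)
  - move=> m mL; rewrite sumy'; case: leqP => mk.
      apply: ler_sum => i _; apply: (@le_trans _ _ (x 0%N)); first exact: xd.
      by apply: xyk; have := ltn_ord i; lia.
    have := xy m.+1 mL; rewrite big_ord_recl /=.
    have -> : \sum_(i < m) x (bump 0 i) = \sum_(i < m) (x \o S) i.
      by apply: eq_bigr.
    by lra.
exists (scons (x 0%N) w') => [|[|i]] //; last by move=> iL; exact: xw'.
apply: (perm_hull_trans (perm_hull_comp (rot_to0_bij k) yw)).
have -> : w \o rot_to0 k = scons (x 0%N) y' by apply/funext => -[|i].
exact: perm_hull_cons.
Qed.

Lemma perm_hull_sum y w : perm_hull y w ->
  exists (N : nat) (c : nat -> R) (s : nat -> nat -> nat),
    [/\ forall l, 0 <= c l, forall l, bijective (s l), \sum_(l < N) c l = 1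
      & forall i, w i = \sum_(l < N) c l * y (s l i)].
Proof.
elim=> [s bs|t u v t01 _ [N [c [s [c0 bs c1 us]]]] _
  [N' [c' [s' [c0' bs' c1' vs]]]]].
  exists 1%N, (fun=> 1), (fun=> s); split => //; first by rewrite big_ord1.
  by move=> i; rewrite big_ord1 mul1r.
exists (N + N')%N,
  (fun l => if (l < N)%N then t * c l else (1 - t) * c' (l - N)%N),
  (fun l => if (l < N)%N then s l else s' (l - N)%N); split.
- by move=> l; case: ifP => _; apply: mulr_ge0 => //; lra.
- by move=> l; case: ifP.
- rewrite big_split_ord /=; under eq_bigr do rewrite ltn_ord.
  under [X in _ + X]eq_bigr do rewrite ltnNge leq_addr /= addKn.
  by rewrite -!mulr_sumr c1 c1'; ring.
- move=> i; rewrite us vs [RHS]big_split_ord /= !mulr_sumr.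
  congr (_ + _); apply: eq_bigr => l _; first by rewrite ltn_ord mulrA.
  by rewrite ltnNge leq_addr /= addKn mulrA.
Qed.

End PermutationHull.

(** * Infinite combinations of permutations, and rearrangements *)

Section NonnegativeSeries.
Variable R : realType.
Implicit Types (u v t : nat -> R) (B : R).

Lemma nneg_series u B : (forall n, 0 <= u n) -> (forall n, series u n <= B) ->
  [/\ cvgn (series u), forall n, series u n <= limn (series u)
    & limn (series u) <= B].
Proof.
move=> u0 uB.
have und : {homo series u : n m / (n <= m)%N >-> n <= m}.
  by apply/nondecreasing_seqP => n; rewrite /series /= big_nat_recr //= lerDl.
have uc : cvgn (series u).
  by apply: nondecreasing_is_cvgn => //; exists B => _ [n _ <-].
split => //; first exact: nondecreasing_cvgn_le.
by apply: limr_le => //; exact: nearW.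
Qed.

Lemma cvg_sum_ord (f : nat -> nat -> R) (l : nat -> R) J :
  (forall j, f j @ \oo --> l j) ->
  (fun n => \sum_(j < J) f j n) @ \oo --> \sum_(j < J) l j.
Proof.
move=> fl; elim: J => [|J IHJ].
  under eq_cvg do rewrite big_ord0.
  by rewrite big_ord0; exact: cvg_cst.
under eq_cvg do rewrite big_ord_recr /=.
by rewrite big_ord_recr; exact: cvgD.
Qed.

Lemma sum_pred1_le (J k : nat) : \sum_(j < J) (k == j)%:R <= 1 :> R.
Proof.
case: (ltnP k J) => [kJ|Jk].
  rewrite (bigD1 (Ordinal kJ)) //= eqxx big1 ?addr0 // => j.
  by rewrite -val_eqE eq_sym /= => /negbTE ->.
rewrite big1 // => j _; rewrite gtn_eqF //; have := ltn_ord j; lia.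
Qed.

Lemma sum_mul_pred1 (J k : nat) (y : nat -> R) : (k < J)%N ->
  \sum_(j < J) (k == j)%:R * y j = y k.
Proof.
move=> kJ; rewrite (bigD1 (Ordinal kJ)) //= eqxx mul1r big1 ?addr0 // => j.
by rewrite -val_eqE eq_sym /= => /negbTE ->; rewrite mul0r.
Qed.

(** The entry [P i j] is the total weight of the [n] with [s n i = j]. A lower bound by finite sums
    suffices and avoids interchanging two infinite sums; the bound [B] makes the row series
    converge. *)
Lemma perm_combination_exists t (s : nat -> nat -> nat) :
    (forall n, 0 < t n) -> series t @ \oo --> (1 : R) ->
    (forall n, bijective (s n)) ->
  exists2 P, infinite_perm_combination P &
    forall (y : nat -> R) B, (forall j, 0 <= y j <= B) ->
      forall i M, \sum_(n < M) t n * y (s n i) <= matrix_apply P y i.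
Proof.
move=> t0 t1 bs.
have st1 M : series t M <= 1.
  have tnd : {homo series t : n m / (n <= m)%N >-> n <= m}.
    apply/nondecreasing_seqP => n.
    by rewrite /series /= big_nat_recr //= lerDl ltW.
  rewrite -(cvg_lim _ t1)//; apply: nondecreasing_cvgn_le => //.
  by apply/cvg_ex; exists 1.
pose u i j n := t n * (s n i == j)%:R.
have u0 i j n : 0 <= u i j n by rewrite mulr_ge0 // ltW.
have ule i j M : series (u i j) M <= 1.
  apply: le_trans (st1 M); apply: ler_sum => n _.
  by rewrite /u; case: eqP => _; rewrite ?mulr1 ?mulr0 // ltW.
pose P i j := limn (series (u i j)).
have uP i j : series (u i j) @ \oo --> P i j.
  by case: (nneg_series (u0 i j) (ule i j)).
have uleP i j M : series (u i j) M <= P i j.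
  by case: (nneg_series (u0 i j) (ule i j)).
have P0 i j : 0 <= P i j.
  by apply: le_trans (uleP i j 0%N); rewrite /series /= big_geq.
have P1 i J : \sum_(j < J) P i j <= 1.
  have cP := @cvg_sum_ord (fun j => series (u i j)) (P i) J (uP i).
  rewrite -(cvg_lim _ cP) //; apply: limr_le.
    by apply/cvg_ex; exists (\sum_(j < J) P i j).
  apply: nearW => M; apply: le_trans (st1 M).
  rewrite /series /= exchange_big /=; apply: ler_sum => n _.
  rewrite /u -mulr_sumr -[leRHS]mulr1; apply: ler_wpM2l; first exact: ltW.
  exact: sum_pred1_le.
exists P.
  exists t, (fun n i j => (s n i == j)%:R); split => //.
    by move=> n; exists (s n).
  move=> n; rewrite t0 /=; apply: le_trans (st1 n.+1).
  rewrite /series /= big_nat_recr //= lerDr; apply: sumr_ge0 => k _; exact: ltW.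
move=> y B yB i M.
have B0 : 0 <= B by have /andP[/le_trans h1 /h1] := yB 0%N.
have y0 j : 0 <= y j by case/andP: (yB j).
have Py0 j : 0 <= P i j * y j by rewrite mulr_ge0.
have PyB J : series (fun j => P i j * y j) J <= B.
  rewrite /series /= big_mkord; apply: (@le_trans _ _ (\sum_(j < J) P i j * B)).
    by apply: ler_sum => j _; apply: ler_wpM2l => //; case/andP: (yB j).
  by rewrite -mulr_suml ler_piMl.
have [_ Pyle _] := nneg_series Py0 PyB.
(* The first [J] columns contain all [s n i] with [n < M], so after interchanging the finite sums
   each inner one picks out [y (s n i)]. *)
pose J := (\max_(n < M) s n i).+1.
apply: le_trans (Pyle J); rewrite /series /= big_mkord.
apply: (@le_trans _ _ (\sum_(j < J) (series (u i j) M) * y j)); last first.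
  by apply: ler_sum => j _; exact: ler_wpM2r.
under [X in _ <= X]eq_bigr do rewrite /series /= mulr_suml.
rewrite exchange_big /= big_mkord; apply: ler_sum => n _.
under eq_bigr do rewrite /u -mulrA.
rewrite -mulr_sumr sum_mul_pred1 //.
by rewrite /J ltnS; exact: (@leq_bigmax _ (fun n : 'I_M => s n i)).
Qed.

(** If [zeta n > 0], the first [n + 1] terms of [v] are positive, and the injection [f] cannot send
    all their indices below [n]. For [i <= n <= f i] one gets [zeta n <= zeta i <= C * v i = C * z
    (f i) <= C * z n]. *)
Lemma rearrangement_ge v z zeta C : monotone_rearrangement v z ->
    (forall n, 0 <= zeta n) -> nonincreasing_seq zeta -> 0 < C ->
  (forall n, zeta n <= C * v n) -> forall n, zeta n <= C * z n.
Proof.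
move=> [[z0 znd _] [f [fS fI _] fz]] zeta0 zetand C0 le n.
have [zn0|zn0] := leP (zeta n) 0;
  first by rewrite (le_trans zn0) // mulr_ge0 // ltW.
have v0 i : (i <= n)%N -> 0 < v i.
  move=> i_n; rewrite -(pmulr_rgt0 _ C0) (lt_le_trans zn0) // (le_trans _ (le
    i)) //.
  exact: zetand.
have [i [i_n nf]] : exists i, (i <= n)%N /\ (n <= f i)%N.
  apply: contrapT => /forallNP h.
  have fn (i : 'I_n.+1) : (f i < n)%N.
    by rewrite ltnNge; apply/negP => nf; apply: (h i); split => //;
      rewrite -ltnS.
  have : (#|'I_n.+1| <= #|'I_n|)%N.
    apply: (@leq_card _ _ (fun i => Ordinal (fn i))) =>
      i j /(congr1 val) /= fij.
    by apply: val_inj; apply: (fI _ _ _ _ fij); apply/mem_set => /=;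
      apply: v0; rewrite -ltnS ltn_ord.
  by rewrite !card_ord ltnn.
apply: (@le_trans _ _ (zeta i)); first exact: zetand.
apply: (le_trans (le i)); rewrite ler_pM2l // -fz ?v0 //; exact: znd.
Qed.

Lemma sum_sub_le (I : eqType) (s1 s2 : seq I) (F : I -> R) :
  (forall i, 0 <= F i) -> uniq s1 -> {subset s1 <= s2} ->
  \sum_(i <- s1) F i <= \sum_(i <- s2) F i.
Proof.
move=> F0; elim: s1 s2 => [|x s1 IHs] s2 /=.
  by move=> _ _; rewrite big_nil; exact: sumr_ge0.
move=> /andP[xs1 us1] s12; have xs2 : x \in s2 by apply: s12; rewrite mem_head.
rewrite (perm_big _ (perm_to_rem xs2)) !big_cons lerD2l; apply: IHs => // i is1.
have := s12 i; rewrite in_cons is1 orbT => /(_ isT).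
rewrite (perm_mem (perm_to_rem xs2)) in_cons => /orP[/eqP ix|//].
by rewrite -ix is1 in xs1.
Qed.

End NonnegativeSeries.

(** * Majorization block by block *)

Section TailMajorization.
Variable R : realType.
Implicit Types (xi eta zeta alpha : nat -> R).

(** Exchanges the block of length [L] starting at [a] with the [a] indices before it, so that a
    majorant built on an initial segment serves that block. *)
Definition block_rot a L j : nat :=
  if (j < a)%N then (j + L)%N else if (j < a + L)%N then (j - a)%N else j.

Lemma block_rotK a L : cancel (block_rot a L) (block_rot L a).
Proof.
move=> j; rewrite [block_rot a L j]/block_rot; case: ltnP => [ja|aj].
  by rewrite /block_rot ltnNge leq_addl /= (addnC L a) ltn_add2r ja addnK.
by case: ltnP => jaL; rewrite /block_rot; do 2?case: ltnP => ?; lia.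
Qed.

Lemma block_rot_bij a L : bijective (block_rot a L).
Proof. by exists (block_rot L a); exact: block_rotK. Qed.

(** [q] packs the number of permutations, the weights and the permutations, so that a single use of
    [choice] covers all blocks. *)
Lemma block_perm_mean xi eta a L : nonincreasing_seq xi ->
    nonincreasing_seq eta ->
    (forall m, \sum_(i < m) xi (a + i)%N <= \sum_(i < m) eta i) ->
  exists q : nat * (nat -> R) * (nat -> nat -> nat),
    [/\ forall l, 0 <= q.1.2 l, forall l, bijective (q.2 l),
      \sum_(l < q.1.1) q.1.2 l = 1
    & forall i, (a <= i < a + L)%N ->
        xi i <= \sum_(l < q.1.1) q.1.2 l * eta (q.2 l i)].
Proof.
move=> xid etad h.
have [w etaw xiw] := @majorized_perm_hull R L (fun i => xi (a + i)%N) eta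
  (fun i j ij => xid _ _ (leq_add (leqnn a) ij)) etad (fun m _ => h m).
have [N [c [s [c0 bs c1 ws]]]] :=
  perm_hull_sum (perm_hull_comp (block_rot_bij a L) etaw).
exists (N, c, s); split => //= i /andP[ai iaL].
rewrite -ws /= /block_rot ltnNge ai /= iaL.
have -> : xi i = xi (a + (i - a))%N by rewrite subnKC.
apply: xiw; lia.
Qed.

Lemma sum_iota (F : nat -> R) M :
  \sum_(n <- iota 0 M) F n = \sum_(n < M) F n.
Proof. by rewrite -(big_mkord xpredT F) /index_iota subn0. Qed.

Lemma sum_half_le1 M : \sum_(n < M) (2^-1 : R) ^+ n.+1 <= 1.
Proof.
suff -> : \sum_(n < M) (2^-1 : R) ^+ n.+1 = 1 - 2^-1 ^+ M.
  by rewrite gerBl exprn_ge0 // invr_ge0.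
elim: M => [|M IHM]; first by rewrite big_ord0 expr0 subrr.
by rewrite big_ord_recr /= IHM !exprS; field.
Qed.

Definition tail_majorized zeta eta := forall eps : R, 0 < eps -> exists N : nat,
  forall n m, (N <= n)%N ->
    \sum_(i < m) zeta (n + i)%N <= eps * \sum_(i < m) eta i.

(* Cut [nat] into blocks so that, on the [k]-th block, [2 ^ k * zeta] is
   majorized by [eta], hence dominated by a finite mean of permutations of
   [eta].  Since the [k]-th block only needs the weight [2 ^ - k], all these
   means fit into one infinite combination of permutations. *)
Lemma tail_majorized_mem (S : set (nat -> R)) eta zeta :
    (forall xi z C, S z -> c0star xi -> 0 < C ->
      (forall n, xi n <= C * z n) -> S xi) ->
    perm_invariant_seqs S -> S eta -> c0star eta -> c0star zeta ->
    (forall m, \sum_(i < m) zeta i <= \sum_(i < m) eta i) ->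
    tail_majorized zeta eta ->
  S zeta.
Proof.
move=> solid invS Seta ceta czeta maj tail.
have [eta0 etad _] := ceta; have [zeta0 zetad _] := czeta.
have h0 k : 0 < (2^-1 : R) ^+ k by rewrite exprn_gt0 // invr_gt0.
have [Nf Nfp] := choice (fun k => tail _ (h0 k)).
(* Block [k] starts late enough for the tail estimate with [2 ^- k]; block 0 starts at 0, where
   plain majorization is used. *)
pose a := fix a k := if k is k'.+1 then maxn (a k').+1 (Nf k) else 0%N.
have aS k : (a k < a k.+1)%N by rewrite /= leq_max leqnn.
pose Q k (r : nat * (nat -> R) * (nat -> nat -> nat)) :=
  [/\ forall l, 0 <= r.1.2 l, forall l, bijective (r.2 l),
    \sum_(l < r.1.1) r.1.2 l = 1
  & forall i, (a k <= i < a k.+1)%N ->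
      2 ^+ k * zeta i <= \sum_(l < r.1.1) r.1.2 l * eta (r.2 l i)].
have [q qp] : {q & forall k, Q k (q k)}.
  apply: choice => k; rewrite /Q.
  have := @block_perm_mean (fun i => 2 ^+ k * zeta i) eta (a k) (a k.+1 - a k).
  rewrite subnKC; last exact: ltnW; apply => //.
    by move=> i j ij; rewrite ler_wpM2l //; exact: zetad.
  move=> m; rewrite -mulr_sumr; case: k => [|k].
    by rewrite expr0 mul1r; under eq_bigr do rewrite add0n; exact: maj.
  have := Nfp k.+1 (a k.+1) m;
    rewrite exprVn mulrC ler_pdivlMr ?exprn_gt0 // mulrC; apply.
  by rewrite /= leq_max leqnn orbT.
(* The pairs of a block and a permutation used on it are enumerated as one sequence. *)
have [f f_bij] : exists f : nat * nat -> nat, bijective f.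
  have /card_set_bijP[f] := card_nat2; rewrite setTT_bijective => bf.
  by exists f.
have [e fK eK] := f_bij.
pose c k l := if (l < (q k).1.1)%N then (q k).1.2 l else 0.
have c0 k l : 0 <= c k l by rewrite /c; case: ifP => // _; case: (qp k).
pose g (p : nat * nat) : R := 2^-1 ^+ p.1 * c p.1 p.2.
have g0 p : 0 <= g p by rewrite mulr_ge0 // ltW.
(* The weights must be strictly positive, while [g] may vanish; hence the extra geometric term.
   Solidity of [S] later absorbs the normalizing factor [T]. *)
pose u n := (2^-1) ^+ n.+1 + g (e n).
have u0 n : 0 < u n by rewrite ltr_pwDl.
have uB M : series u M <= 3.
  rewrite /series /= big_mkord big_split /=.
  have -> : 3 = 1 + 2 :> R by lra.
  apply: lerD; first exact: sum_half_le1.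
  (* Finitely many pairs fit into a square of side [K], whose row [k] contributes at most [2 ^- k],
     as the weights of each mean have sum 1. *)
  pose s1 := [seq e n | n <- iota 0 M].
  pose K := (\max_(p <- s1) maxn p.1 p.2).+1.
  have -> : \sum_(n < M) g (e n) = \sum_(p <- s1) g p.
    by rewrite big_map sum_iota.
  apply: (@le_trans _ _ (\sum_(p <- [seq (k, l) | k <- iota 0 K,
    l <- iota 0 K]) g p)).
    apply: sum_sub_le => //; first by rewrite map_inj_uniq ?iota_uniq //;
      exact: can_inj eK.
    move=> [k l] kl; have : (maxn k l < K)%N.
      by rewrite ltnS; apply: (@leq_bigmax_seq _ _ xpredT (fun p : nat * nat
        => maxn p.1 p.2) _ kl).
    by rewrite gtn_max => /andP[kK lK]; apply: allpairs_f; rewrite mem_iota.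
  rewrite big_allpairs /=.
  apply: (@le_trans _ _ (\sum_(k <- iota 0 K) (2^-1 : R) ^+ k)).
    apply: ler_sum => k _; rewrite -mulr_sumr -[leRHS]mulr1.
    apply: ler_wpM2l; first exact: ltW.
    case: (qp k) => q0 _ q1 _.
    rewrite -q1 /c -(sum_iota (q k).1.2) -big_mkcond -big_filter.
    apply: sum_sub_le => //.
      exact/filter_uniq/(iota_uniq 0 K).
    by move=> l; rewrite mem_filter mem_iota => /andP[].
  rewrite sum_iota.
  have := sum_half_le1 K; under eq_bigr do rewrite exprS.
  by rewrite -mulr_sumr; lra.
have [uc uT _] := nneg_series (fun n => ltW (u0 n)) uB.
set T := limn (series u) in uT.
have T0 : 0 < T.
  by apply: lt_le_trans (uT 1%N); rewrite /series /= big_nat1.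
pose t n := u n / T.
have t0 n : 0 < t n by rewrite divr_gt0.
have t1 : series t @ \oo --> (1 : R).
  have -> : series t = (fun n => series u n * T^-1).
    by apply/funext => n; rewrite /series /= mulr_suml.
  rewrite -(divff (lt0r_neq0 T0)); apply: cvgM; [exact: uc|exact: cvg_cst].
pose s n := (q (e n).1).2 (e n).2.
have bs n : bijective (s n) by case: (qp (e n).1) => _ bq _ _; exact: bq.
have [P combP Ple] := perm_combination_exists t0 t1 bs.
have [z rz Sz] := invS _ _ combP Seta.
have etaB j : 0 <= eta j <= eta 0%N by rewrite eta0 etad.
apply: (solid _ _ _ Sz czeta T0).
apply: (rearrangement_ge rz zeta0 zetad T0) => i.
have [k /andP[ki ik]] : exists k, (a k <= i < a k.+1)%N.
  have ka k : (k <= a k)%N by elim: k => // k IHk;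
    exact: leq_ltn_trans IHk (aS k).
  have ex : exists k, (a k <= i)%N by exists 0%N.
  have bd k : (a k <= i)%N -> (k <= i)%N by exact: leq_trans (ka k).
  case: (ex_maxnP ex bd) => k ki kmax; exists k; rewrite ki ltnNge.
  by apply/negP => /kmax; rewrite ltnn.
case: (qp k) => _ _ _ /(_ i); rewrite ki ik => /(_ isT) zle.
set N := (q k).1.1 in zle.
(* Only the pairs [(k, l)], all coded below [M], are kept: they contribute [2 ^- k] times the mean
   that dominates [2 ^ k * zeta i]. *)
pose M := (\max_(l < N) f (k, nat_of_ord l)).+1.
apply: le_trans (ler_wpM2l (ltW T0) (Ple _ _ etaB i M)).
pose F n := g (e n) * eta (s n i).
have F0 n : 0 <= F n by rewrite mulr_ge0.
apply: (@le_trans _ _ (\sum_(n < M) F n)); last first.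
  rewrite mulr_sumr; apply: ler_sum => n _; rewrite /t /F.
  rewrite [leRHS](_ : _ = u n * eta (s n i)); last by field; rewrite gt_eqF.
  by rewrite ler_wpM2r // lerDr ltW.
apply: (@le_trans _ _ (\sum_(n <- [seq f (k, l) | l <- iota 0 N]) F n));
  last first.
  rewrite -[leRHS]sum_iota; apply: sum_sub_le => //.
    by rewrite map_inj_uniq ?iota_uniq // => l l' /(can_inj fK)[].
  move=> _ /mapP[l lN ->]; rewrite mem_iota /= add0n ltnS.
  rewrite mem_iota /= add0n in lN.
  exact: (@leq_bigmax _ (fun l : 'I_N => f (k, nat_of_ord l)) (Ordinal lN)).
rewrite big_map sum_iota.
under eq_bigr => l _.
  rewrite /F /s /g fK /= /c -/N ltn_ord -mulrA; over.
rewrite -mulr_sumr exprVn mulrC ler_pdivlMr ?exprn_gt0 // mulrC.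
exact: zle.
Qed.
End TailMajorization.

(** * Soft-edged and soft-complemented sets of sequences *)

Section SoftMajorization.
Variable R : realType.
Implicit Types (xi eta zeta alpha : nat -> R) (S : set (nat -> R)).

Lemma c0star_lt xi eps : c0star xi -> 0 < eps ->
  exists N, forall n, (N <= n)%N -> xi n < eps.
Proof.
move=> [xi0 _ /cvgrPdist_lt cxi] eps0; have [N _ Np] := cxi _ eps0.
exists N => n /Np; rewrite sub0r normrN; exact: le_lt_trans (ler_norm _).
Qed.

Lemma c0starZ xi C : 0 <= C -> c0star xi -> c0star (fun n => C * xi n).
Proof.
move=> C0 [xi0 xid xic]; split.
- by move=> n; rewrite mulr_ge0.
- by move=> n m nm; rewrite ler_wpM2l //; exact: xid.
- by rewrite -(mulr0 C); apply: cvgM => //; exact: cvg_cst.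
Qed.

Lemma c0starM xi eta : c0star xi -> c0star eta ->
  c0star (fun n => xi n * eta n).
Proof.
move=> [xi0 xid xic] [eta0 etad etac]; split.
- by move=> n; rewrite mulr_ge0.
- by move=> n m nm; rewrite ler_pM //; [exact: xid|exact: etad].
- by rewrite -(mulr0 0); exact: cvgM.
Qed.

(** Past [N] the factor [alpha] is below [eps], and a stretch of the nonincreasing [xi] sums to at
    most its initial segment of the same length. *)
Lemma tail_majorizedM xi eta alpha : c0star xi -> c0star alpha ->
    (forall m, \sum_(i < m) xi i <= \sum_(i < m) eta i) ->
  tail_majorized (fun n => alpha n * xi n) eta.
Proof.
move=> [xi0 xid _] calpha maj eps eps0.
have [N Np] := c0star_lt calpha eps0; exists N => n m Nn.
apply: le_trans (ler_wpM2l (ltW eps0) (maj m)); rewrite mulr_sumr.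
apply: ler_sum => i _; apply: ler_pM => //; first by case: calpha.
- by apply/ltW/Np; lia.
- by apply: xid; exact: leq_addl.
Qed.

(** If [xi] is summable, its tails fall below [eps * eta 0]. Otherwise the sums of [alpha * eta] are
    at most a constant plus [eps / 2] times those of [eta]; the divergent sums of [xi] absorb the
    constant, which settles long stretches. Short ones are small because [xi] tends to 0. *)
Lemma tail_majorized_soft xi eta alpha : c0star xi -> c0star eta ->
    c0star alpha ->
    (forall m, \sum_(i < m) xi i <= \sum_(i < m) alpha i * eta i) ->
  tail_majorized xi eta.
Proof.
move=> cxi ceta calpha maj eps eps0.
have [xi0 xid xil] := cxi; have [eta0 etad _] := ceta.
have [alpha0 _ _] := calpha.
have splitxi n m :
    \sum_(i < m) xi (n + i)%N = \sum_(i < n + m) xi i - \sum_(i < n) xi i.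
  by rewrite big_split_ord /= [RHS]addrC addKr.
have [e0|e0] := leP (eta 0%N) 0.
  exists 0%N => n m _.
  have eta_eq0 i : eta i = 0.
    by apply/eqP; rewrite eq_le eta0 (le_trans _ e0) //; exact: etad.
  rewrite splitxi [X in _ * X]big1 // mulr0 subr_le0.
  apply: le_trans (maj _) _; rewrite big1 ?sumr_ge0 // => i _.
  by rewrite eta_eq0 mulr0.
have e0S m : (0 < m)%N -> eps * eta 0%N <= eps * \sum_(i < m) eta i.
  case: m => // m _; rewrite ler_pM2l // big_ord_recl lerDl.
  exact: sumr_ge0.
have ee0 : 0 < eps * eta 0%N by rewrite mulr_gt0.
have [[B xiB]|unb] := pselect (exists B, forall m, \sum_(i < m) xi i <= B).
  have xiB' m : series xi m <= B by rewrite /series /= big_mkord.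
  have [xic xile _] := nneg_series xi0 xiB'.
  move/cvgrPdist_lt: (xic) => /(_ _ ee0)[N _ Np].
  exists N => n [|m] Nn; first by rewrite !big_ord0 mulr0.
  apply: le_trans (e0S _ (ltn0Sn m)); rewrite splitxi.
  have := xile (n + m.+1)%N; have := Np n Nn.
  rewrite ltr_norml /series /= !big_mkord => /andP[_]; lra.
have h0 : 0 < eps / 2 by lra.
have [K Kp] := c0star_lt calpha h0.
pose D := \sum_(i < K) alpha i * eta i.
(* Beyond [M0] the constant [D] is less than half the sum of [xi], so [sumD] bounds that sum by
   [eps] times the sum of [eta]. *)
have [M0 M0p] : exists M0, 2 * D < \sum_(i < M0) xi i.
  apply: contrapT => /forallNP h; apply: unb; exists (2 * D) => m.
  by rewrite leNgt; apply/negP/h.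
have sumD m : \sum_(i < m) alpha i * eta i <= D + eps / 2 * \sum_(i < m) eta i.
  rewrite mulr_sumr; have [mK|Km] := leqP m K.
    rewrite /D -(subnKC mK) big_split_ord /= -addrA lerDl.
    by rewrite addr_ge0 // sumr_ge0 // => i _; rewrite mulr_ge0 // ltW.
  rewrite -(subnKC (ltnW Km)) !big_split_ord /= lerD2l.
  apply: (@le_trans _ _ (\sum_(i < m - K) eps / 2 * eta (K + i)%N)).
    by apply: ler_sum => i _; rewrite ler_wpM2r // ltW // Kp ?leq_addr.
  by rewrite lerDr sumr_ge0 // => i _; rewrite mulr_ge0 // ltW.
have big m : (M0 <= m)%N -> \sum_(i < m) xi i <= eps * \sum_(i < m) eta i.
  move=> M0m; have : 2 * D < \sum_(i < m) xi i.
    apply: (lt_le_trans M0p); rewrite -(subnKC M0m) big_split_ord /= lerDl.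
    exact: sumr_ge0.
  have := sumD m; have := maj m; lra.
(* Fewer than [M0] terms, each below this bound, sum to at most [eps * eta 0]. *)
have d0 : 0 < eps * eta 0%N / M0.+1%:R by rewrite divr_gt0.
have [N Np] := c0star_lt cxi d0; exists N => n [|m] Nn.
  by rewrite !big_ord0 mulr0.
have [M0m|mM0] := leqP M0 m.+1.
  apply: le_trans (big _ M0m); apply: ler_sum => i _; apply: xid.
  exact: leq_addl.
apply: le_trans (e0S _ (ltn0Sn m)).
have := Np n Nn; rewrite ltr_pdivlMr // => /ltW; apply: le_trans.
apply: (@le_trans _ _ (\sum_(i < m.+1) xi n)).
  by apply: ler_sum => i _; apply: xid; exact: leq_addr.
rewrite sumr_const card_ord -[leLHS]mulr_natr; apply: ler_wpM2l => //.
by rewrite ler_nat; lia.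
Qed.

(** The majorant is multiplied by [alpha 0 + 1]: this number bounds [alpha], which gives
    majorization from 0 on, and is at least 1, which preserves tail majorization. *)
Lemma majorized_mem S eta xi :
    (forall eta, S eta -> c0star eta) ->
    (forall xi z C, S z -> c0star xi -> 0 < C ->
      (forall n, xi n <= C * z n) -> S xi) ->
    soft_edged_seqs S \/ soft_complemented_seqs S ->
    perm_invariant_seqs S -> S eta -> c0star xi ->
    (forall m, \sum_(i < m) xi i <= \sum_(i < m) eta i) ->
  S xi.
Proof.
move=> Sc0 solid softS invS Seta cxi maj; have ceta := Sc0 _ Seta.
have SZ C z : 0 < C -> S z -> S (fun n => C * z n).
  move=> C0 Sz; apply: (solid _ z C) => //.
  by apply: c0starZ; [exact: ltW|exact: Sc0].
have alpha_sum alpha z m : c0star alpha -> c0star z ->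
    \sum_(i < m) alpha i * z i <= \sum_(i < m) (alpha 0%N + 1) * z i.
  move=> [alpha0 alphad _] [z0 _ _]; apply: ler_sum => i _.
  by rewrite ler_wpM2r // ler_wpDr //; exact: alphad.
have tailZ C zeta z : 1 <= C -> c0star z -> tail_majorized zeta z ->
    tail_majorized zeta (fun n => C * z n).
  move=> C1 [z0 _ _] h eps eps0; have [N Np] := h _ eps0; exists N => n m Nn.
  apply: (le_trans (Np n m Nn)); rewrite -mulr_sumr mulrCA.
  by rewrite ler_peMl // mulr_ge0 ?sumr_ge0 // ltW.
have A1 alpha : c0star alpha -> 1 <= alpha 0%N + 1.
  by move=> [/(_ 0%N)]; lra.
case: softS => soft.
  have [alpha [eta1 [calpha Seta1 etaE]]] := (soft _ ceta).1 Seta.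
  have ceta1 := Sc0 _ Seta1; have A1' := A1 _ calpha.
  have A0 : 0 < alpha 0%N + 1 by lra.
  rewrite etaE in maj.
  apply: (tail_majorized_mem solid invS (SZ _ _ A0 Seta1)) => //.
  - by apply: c0starZ => //; exact: ltW.
  - by move=> m; apply: le_trans (maj m) _; exact: alpha_sum.
  - by apply: tailZ => //; exact: tail_majorized_soft maj.
apply/(soft _ cxi) => alpha calpha; have A1' := A1 _ calpha.
have A0 : 0 < alpha 0%N + 1 by lra.
apply: (tail_majorized_mem solid invS (SZ _ _ A0 Seta)) => //.
- by apply: c0starZ => //; exact: ltW.
- exact: c0starM.
- move=> m; apply: le_trans (alpha_sum _ _ _ calpha cxi) _.
  by rewrite -!mulr_sumr ler_wpM2l // ltW.
- by apply: tailZ => //; exact: tail_majorizedM.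
Qed.

Lemma sum_amean xi n : \sum_(i < n.+1) xi i = n.+1%:R * amean xi n.
Proof. by rewrite /amean mulrA divff ?mul1r // pnatr_eq0. Qed.

Lemma amean_c0star xi : c0star xi -> c0star (amean xi).
Proof.
move=> [xi0 xid xic]; split.
- by move=> n; rewrite mulr_ge0 ?invr_ge0 ?sumr_ge0.
- apply/nonincreasing_seqP => n; have n0 : 0 < n.+2%:R :> R by [].
  rewrite -(ler_pM2l n0) -sum_amean big_ord_recr /= sum_amean.
  rewrite -(natr1 n.+1) mulrDl mul1r lerD2l /amean ler_pdivlMl // mulrC.
  have -> : xi n.+1 * n.+1%:R = \sum_(i < n.+1) xi n.+1.
    by rewrite sumr_const card_ord mulr_natr.
  by apply: ler_sum => i _; apply: xid; apply: ltnW; exact: ltn_ord.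
- have -> : amean xi = arithmetic_mean xi.
    by apply/funext => n; rewrite /amean /arithmetic_mean /series /= big_mkord.
  exact: cesaro.
Qed.

End SoftMajorization.

(** * Orthonormal systems *)

Section ComplexModulus.
Variable R : realType.
Implicit Types (z : R[i]) (a : R).

Lemma normr_normc z : `|z| = (normc z)%:C. Proof. by []. Qed.

Lemma normc_ge0 z : 0 <= normc z.
Proof. by rewrite -ler0c -normr_normc. Qed.

Lemma normc_eq0 z : (normc z == 0) = (z == 0).
Proof. by apply/eqP/eqP => [/eq0_normc|->] //; rewrite normc0. Qed.

Lemma normc_sqE z : z * z^* = (normc z ^+ 2)%:C.
Proof. by rewrite -normCK normr_normc rmorphXn. Qed.

Lemma normc_real a : normc (a%:C) = `|a|.
Proof. by rewrite /normc /= expr0n addr0 sqrtr_sqr. Qed.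

Lemma conj_real a : (a%:C)^* = a%:C.
Proof. by apply: conj_Creal; apply/complex_realP; exists a. Qed.

Lemma normc_conj z : normc z^* = normc z.
Proof. by apply: complexI; rewrite -!normr_normc norm_conjC. Qed.

Lemma abs_Re_le z : `|complex.Re z| <= normc z.
Proof.
by case: z => a b; rewrite /normc /= -sqrtr_sqr ler_wsqrtr // lerDl sqr_ge0.
Qed.

Lemma abs_Im_le z : `|complex.Im z| <= normc z.
Proof.
by case: z => a b; rewrite /normc /= -sqrtr_sqr ler_wsqrtr // lerDr sqr_ge0.
Qed.

Lemma addcJ_Re z : z + z^* = (2 * complex.Re z)%:C.
Proof. by rewrite -[z^*]/(conjc z) addcJ rmorphM /= rmorph_nat. Qed.

Lemma pos_realC z : 0 < z -> exists2 a, 0 < a & z = a%:C.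
Proof.
move=> z0; have /complex_realP[a za] : z \is Num.real by rewrite gtr0_real.
by exists a => //; rewrite -ltcR -za.
Qed.

End ComplexModulus.

(** * Hilbert space geometry and norm convergence *)

Section HilbertSpace.
Variables (R : realType) (H : completeNormedModType R[i]).
Variable dot : {dot H for (@conjC R[i])}.
Hypothesis norm_dot : forall x : H, `|x| ^+ 2 = dot x x.
Implicit Types (x y z u v w : H) (a b c : R[i]) (p q : pred nat)
  (e f : nat -> H).

(** The norm of [H] takes values in [R[i]]; its real part gives access to the order and the limits
    of [R]. *)
Definition nr x : R := complex.Re `|x|.

Lemma nrE x : `|x| = (nr x)%:C.
Proof. by rewrite RRe_real ?normr_real. Qed.

Lemma nr_ge0 x : 0 <= nr x.
Proof. by rewrite -ler0c -nrE. Qed.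

Lemma dotxx x : dot x x = (nr x ^+ 2)%:C.
Proof. by rewrite -norm_dot nrE rmorphXn. Qed.

Lemma norm_le1 x : (`|x| <= 1) = (nr x <= 1).
Proof. by rewrite nrE -(lecR _ 1). Qed.

Lemma nr0 : nr 0 = 0.
Proof. by apply: complexI; rewrite -nrE normr0. Qed.

Lemma nr_eq0 x : (nr x == 0) = (x == 0).
Proof.
by rewrite -(normr_eq0 x) nrE -(inj_eq (@complexI R)).
Qed.

Lemma nrZ a x : nr (a *: x) = normc a * nr x.
Proof. by apply: complexI; rewrite -nrE normrZ nrE normr_normc rmorphM. Qed.

Lemma nrN x : nr (- x) = nr x.
Proof. by apply: complexI; rewrite -!nrE normrN. Qed.

Lemma nrBC x y : nr (x - y) = nr (y - x).
Proof. by rewrite -nrN opprB. Qed.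

Lemma nrD x y : nr (x + y) <= nr x + nr y.
Proof. by rewrite -lecR rmorphD /= -!nrE ler_normD. Qed.

Lemma nr_triangle y x z : nr (x - z) <= nr (x - y) + nr (y - z).
Proof. by rewrite (le_trans _ (nrD _ _)) // addrA subrK. Qed.

Lemma nrB_ge x y : nr x - nr y <= nr (x - y).
Proof. by have := nrD (x - y) y; rewrite subrK; lra. Qed.

Lemma nr_sum n (F : 'I_n -> H) : nr (\sum_(i < n) F i) <= \sum_(i < n) nr (F i).
Proof.
elim/big_ind2 : _ => // [|x a y b hx hy]; first by rewrite nr0.
by rewrite (le_trans (nrD _ _)) // lerD.
Qed.

Lemma dotC x y : dot x y = (dot y x)^*.
Proof. by rewrite (@hermC _ _ (@conjC R[i])) expr0 mul1r. Qed.

Lemma dotDl x y z : dot (x + y) z = dot x z + dot y z.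
Proof. exact: linearDl. Qed.

Lemma dotBl x y z : dot (x - y) z = dot x z - dot y z.
Proof. exact: linearBl. Qed.

Lemma dotZl a x y : dot (a *: x) y = a * dot x y.
Proof. exact: linearZl_LR. Qed.

Lemma dot0l y : dot 0 y = 0.
Proof. exact: linear0l. Qed.

Lemma dotBr x y z : dot x (y - z) = dot x y - dot x z.
Proof. exact: linearBr. Qed.

Lemma dotZr a x y : dot x (a *: y) = a^* * dot x y.
Proof. exact: linearZr_LR. Qed.

Lemma dot0r y : dot y 0 = 0.
Proof. exact: linear0r. Qed.

Lemma dot_suml n (F : 'I_n -> H) y :
  dot (\sum_(i < n) F i) y = \sum_(i < n) dot (F i) y.
Proof. exact: linear_sumlz. Qed.

Lemma dot_eq0C x y : dot x y = 0 -> dot y x = 0.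
Proof. by move=> h; rewrite dotC h rmorph0. Qed.

Lemma dot_inj x y : (forall z, dot z x = dot z y) -> x = y.
Proof.
move=> h; apply/eqP; rewrite -subr_eq0 -nr_eq0 -sqrf_eq0; apply/eqP.
by apply: complexI; rewrite -dotxx dotBr h subrr.
Qed.

Lemma nrD_sq x y :
  nr (x + y) ^+ 2 = nr x ^+ 2 + nr y ^+ 2 + 2 * complex.Re (dot x y).
Proof.
by apply: complexI; rewrite -dotxx dnormD addcJ_Re !rmorphD /= -!dotxx.
Qed.

Lemma nrD_orth x y : dot x y = 0 -> nr (x + y) ^+ 2 = nr x ^+ 2 + nr y ^+ 2.
Proof. by move=> h; rewrite nrD_sq h /= mulr0 addr0. Qed.

Lemma parallelogram x y :
  nr (x - y) ^+ 2 = 2 * nr x ^+ 2 + 2 * nr y ^+ 2 - nr (x + y) ^+ 2.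
Proof.
rewrite !nrD_sq nrN linearNr /=.
have -> : complex.Re (- dot x y) = - complex.Re (dot x y) by case: (dot x y).
by ring.
Qed.

(* The vectors with an index outside [p] are 0. *)
Definition onsys p e := forall m n, dot (e m) (e n) = ((m == n) && p n)%:R.

Lemma onsys_out p e n : onsys p e -> ~~ p n -> e n = 0.
Proof.
move=> one pn; apply/eqP; rewrite -nr_eq0 -sqrf_eq0; apply/eqP.
by apply: complexI; rewrite -dotxx one (negbTE pn) andbF.
Qed.

Lemma onsys_nr p e n : onsys p e -> nr (e n) = (p n)%:R.
Proof.
move=> one; have [pn|pn] := boolP (p n); last by rewrite (onsys_out one pn) nr0.
apply/eqP; rewrite -(@eqrXn2 _ 2) ?nr_ge0 //; apply/eqP; apply: complexI.
by rewrite -dotxx one eqxx pn /= expr1n.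
Qed.

Lemma onsys_dot p e x n : onsys p e -> ~~ p n -> dot x (e n) = 0.
Proof. by move=> one /(onsys_out one) ->; rewrite dot0r. Qed.

Lemma onsys_dot_sum p e (c : nat -> R[i]) N j : onsys p e ->
  dot (\sum_(i < N) c i *: e i) (e j) = c j * ((j < N)%N && p j)%:R.
Proof.
move=> one; rewrite dot_suml; under eq_bigr do rewrite dotZl one.
have [jN|Nj] := ltnP j N.
  rewrite (bigD1 (Ordinal jN)) //= eqxx /= big1 ?addr0 // => i.
  by rewrite -val_eqE /= => /negbTE ->; rewrite mulr0.
rewrite big1 /= ?mulr0 // => i _; rewrite ltn_eqF ?mulr0 //.
exact: leq_trans (ltn_ord i) Nj.
Qed.

Lemma onsys_nr_sum p e (c : nat -> R[i]) N : onsys p e ->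
  nr (\sum_(i < N) c i *: e i) ^+ 2 = \sum_(i < N) normc (c i) ^+ 2 * (p i)%:R.
Proof.
move=> one; elim: N => [|N IHN]; first by rewrite !big_ord0 nr0 expr0n.
rewrite !big_ord_recr /= nrD_orth ?IHN.
  by rewrite nrZ (onsys_nr _ one) exprMn; case: (p N); rewrite ?expr1n ?expr0n.
by rewrite dotZr (onsys_dot_sum _ _ _ one) ltnn !mulr0.
Qed.

Definition onproj e N x := \sum_(i < N) dot x (e i) *: e i.

Lemma onproj_dot p e N x j : onsys p e ->
  dot (onproj e N x) (e j) = if (j < N)%N then dot x (e j) else 0.
Proof.
move=> one; rewrite /onproj (onsys_dot_sum (fun i => dot x (e i)) _ _ one).
have [pj|pj] := boolP (p j); rewrite ?andbT ?andbF.
  by case: ifP; rewrite ?mulr1 ?mulr0.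
by rewrite mulr0 (onsys_dot _ one pj) if_same.
Qed.

Lemma onprojB_dot p e N x j : onsys p e -> (j < N)%N ->
  dot (x - onproj e N x) (e j) = 0.
Proof. by move=> one jN; rewrite dotBl (onproj_dot _ _ _ one) jN subrr. Qed.

Lemma bessel_eq p e N x : onsys p e ->
  nr x ^+ 2 = nr (x - onproj e N x) ^+ 2 +
    \sum_(i < N) normc (dot x (e i)) ^+ 2.
Proof.
move=> one; rewrite -{1}(subrK (onproj e N x) x) (@nrD_orth (x - onproj e N
  x)); last first.
  apply: dot_eq0C; rewrite {1}/onproj dot_suml big1 // => i _.
  by rewrite dotZl (dot_eq0C (onprojB_dot x one (ltn_ord i))) mulr0.
rewrite /onproj (onsys_nr_sum (fun i => dot x (e i)) _ one); congr (_ + _).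
apply: eq_bigr => i _; have [pi|pi] := boolP (p i); first by rewrite mulr1.
by rewrite (onsys_dot _ one pi) normc0 expr0n mul0r.
Qed.

Lemma bessel p e N x : onsys p e ->
  \sum_(i < N) normc (dot x (e i)) ^+ 2 <= nr x ^+ 2.
Proof. by move=> one; rewrite (bessel_eq N x one) lerDr sqr_ge0. Qed.

Lemma nr_onprojB p e N x : onsys p e -> nr (x - onproj e N x) <= nr x.
Proof.
move=> one; rewrite -ler_sqr ?nnegrE ?nr_ge0 // (bessel_eq N x one) lerDl.
by apply: sumr_ge0 => i _; exact: sqr_ge0.
Qed.

(** Bessel's inequality for the single unit vector [y / nr y], continued by zero vectors. *)
Lemma cauchy_schwarz x y : normc (dot x y) <= nr x * nr y.
Proof.
have [->|y0] := eqVneq y 0; first by rewrite dot0r normc0 nr0 mulr0.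
have ny0 : nr y != 0 by rewrite nr_eq0.
pose e n := if n is 0%N then (nr y)^-1%:C *: y else 0.
have one : onsys (pred1 0%N) e.
  move=> [|m] [|n]; rewrite /e ?dot0l ?dot0r //=; last by rewrite andbF.
  rewrite dotZl dotZr conj_real dotxx -!rmorphM /=.
  by rewrite (_ : _ * _ = 1) //; field.
have := bessel 1 x one; rewrite big_ord1 /= dotZr conj_real normcM normc_real.
rewrite ler_sqr ?nnegrE ?mulr_ge0 ?normc_ge0 ?nr_ge0 //.
by rewrite normfV ger0_norm ?nr_ge0 // ler_pdivrMl ?lt_def ?ny0 ?nr_ge0 //
  mulrC.
Qed.

Definition ncvg (u : nat -> H) v := (fun n => nr (u n - v)) @ \oo --> (0 : R).

Lemma ncvgP (s : nat -> H) v : ncvg s v <->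
  forall eps : R, 0 < eps ->
    exists N, forall n, (N <= n)%N -> nr (s n - v) < eps.
Proof.
rewrite /ncvg; split=> [/cvgrPdist_lt h eps /h[N _ Np]|h].
  by exists N => n /Np; rewrite sub0r normrN ger0_norm ?nr_ge0.
apply/cvgrPdist_lt => eps /h[N Np]; exists N => // n /= /Np.
by rewrite sub0r normrN ger0_norm ?nr_ge0.
Qed.

Lemma small_eq0 (a : R) : 0 <= a -> (forall eps, 0 < eps -> a <= eps) -> a = 0.
Proof.
move=> a0 h; apply/eqP; rewrite eq_le a0 andbT leNgt; apply/negP => ap.
by have := h (a / 2); lra.
Qed.

Lemma ncvg_uniq s v w : ncvg s v -> ncvg s w -> v = w.
Proof.
move=> /ncvgP sv /ncvgP sw; apply/eqP; rewrite -subr_eq0 -nr_eq0; apply/eqP.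
apply: small_eq0; rewrite ?nr_ge0 // => eps eps0.
have [|N1 h1] := sv (eps / 2); first lra.
have [|N2 h2] := sw (eps / 2); first lra.
have := nr_triangle (s (maxn N1 N2)) v w; rewrite (nrBC v (s _)).
have := h1 _ (leq_maxl N1 N2); have := h2 _ (leq_maxr N1 N2); lra.
Qed.

Lemma ncvg_squeeze s v (r : nat -> R) : (forall n, nr (s n - v) <= r n) ->
  r @ \oo --> (0 : R) -> ncvg s v.
Proof.
move=> h r0; apply: (@squeeze_cvgr _ _ _ _ (fun=> 0) r) => //.
  by apply: nearW => n; rewrite nr_ge0 h.
exact: cvg_cst.
Qed.

Lemma ncvg_lipschitz (C : R) s v (T : H -> H) :
  (forall x y, nr (T x - T y) <= C * nr (x - y)) ->
  ncvg s v -> ncvg (fun n => T (s n)) (T v).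
Proof.
move=> TC sv; apply: (@ncvg_squeeze _ _ (fun n => C * nr (s n - v))) => //.
by rewrite -(mulr0 C); apply: cvgM => //; exact: cvg_cst.
Qed.

Lemma ncvg_comb a s v t w : ncvg s v -> ncvg t w ->
  ncvg (fun n => a *: s n + t n) (a *: v + w).
Proof.
move=> sv tw; apply: (@ncvg_squeeze _ _ (fun n =>
  normc a * nr (s n - v) + nr (t n - w))).
  by move=> n; rewrite -nrZ scalerBr opprD addrACA nrD.
rewrite -[0](addr0 0) -{1}(mulr0 (normc a)); apply: cvgD => //.
by apply: cvgM => //; exact: cvg_cst.
Qed.

Lemma ncvg_nr_le s v B : ncvg s v -> (forall n, nr (s n) <= B) -> nr v <= B.
Proof.
move=> /ncvgP sv sB; rewrite leNgt; apply/negP => Bv.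
have [|N /(_ N (leqnn _))] := sv (nr v - B); first lra.
have := sB N; have := nrB_ge v (s N); rewrite nrBC; lra.
Qed.

Lemma ncvg_dot_eq s v y b (N : nat) : ncvg s v ->
  (forall n, (N <= n)%N -> dot (s n) y = b) -> dot v y = b.
Proof.
move=> /ncvgP sv sb; apply/eqP; rewrite -subr_eq0 -normc_eq0; apply/eqP.
apply: small_eq0; rewrite ?normc_ge0 // => eps eps0.
have y0 : 0 < nr y + 1 by rewrite ltr_wpDl ?nr_ge0.
have [|M Mp] := sv (eps / (nr y + 1)); first by rewrite divr_gt0.
rewrite -(sb (maxn N M)) ?leq_maxl // -dotBl (le_trans (cauchy_schwarz _ _)) //.
have := Mp _ (leq_maxr N M); rewrite nrBC ltr_pdivlMr // => /ltW;
  apply: le_trans.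
by rewrite ler_wpM2l ?nr_ge0 // lerDl.
Qed.

Lemma cvg_nrP (T : Type) (F : set_system T) (FF : Filter F) (g : T -> H) v :
  g @ F --> v <->
  forall eps : R, 0 < eps -> \forall t \near F, nr (v - g t) < eps.
Proof.
split=> [/cvgrPdist_lt h eps eps0|h].
  have := h eps%:C; rewrite ltcR => /(_ eps0); apply: filterS => t.
  by rewrite nrE ltcR.
apply/cvgrPdist_lt => z /pos_realC[eps eps0 ->].
by apply: filterS (h _ eps0) => t; rewrite nrE ltcR.
Qed.

Lemma cauchy_conv (s : nat -> H) :
    (forall eps : R, 0 < eps ->
      exists N, forall n, (N <= n)%N -> nr (s N - s n) < eps) ->
  exists v, ncvg s v.
Proof.
move=> h; have : cauchy (s @ \oo).
  apply: cauchy_exP => z /pos_realC[eps /h[N Np] ->]; exists (s N).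
  by exists N => // n /= /Np; rewrite -ball_normE /= nrE ltcR.
move/cauchy_cvg => sc; exists (lim (s @ \oo)); apply/ncvgP => eps eps0.
move/cvg_nrP : sc => /(_ _ eps0)[N _ Np].
by exists N => n /Np; rewrite nrBC.
Qed.

(** Riesz-Fischer: the squared norm of a stretch of the series is at most the same stretch of the
    convergent sum of squares. *)
Lemma onsys_series p e (c : nat -> R[i]) (B : R) : onsys p e ->
    (forall N, \sum_(i < N) normc (c i) ^+ 2 <= B) ->
  exists v, ncvg (fun N => \sum_(i < N) c i *: e i) v.
Proof.
move=> one cB; apply: cauchy_conv => eps eps0.
pose S N := \sum_(i < N) normc (c i) ^+ 2.
have Snd : {homo S : n m / (n <= m)%N >-> n <= m}.
  by apply/nondecreasing_seqP => n; rewrite /S big_ord_recr /= lerDl sqr_ge0.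
have Sc : cvgn S by apply: nondecreasing_is_cvgn => //;
  exists B => _ [n _ <-]; exact: cB.
have Sl n : S n <= limn S by apply: nondecreasing_cvgn_le.
have eps2 : 0 < eps ^+ 2 by rewrite exprn_gt0.
move/cvgrPdist_lt : Sc => /(_ _ eps2)[N _ Np]; exists N => n Nn.
rewrite -ltr_sqr ?nnegrE ?nr_ge0 ?(ltW eps0) // nrBC.
have -> : \sum_(i < n) c i *: e i - \sum_(i < N) c i *: e i =
   \sum_(i < n) (if (i < N)%N then 0 else c i) *: e i.
  rewrite -(subnKC Nn) !big_split_ord /= [LHS]addrC addKr [X in _ =
    X + _]big1 ?add0r.
    by apply: eq_bigr => i _; rewrite ltnNge leq_addr.
  by move=> i _; rewrite ltn_ord scale0r.
rewrite (onsys_nr_sum (fun i => if (i < N)%N then 0 else c i) _ one).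
apply: (@le_lt_trans _ _ (S n - S N)); last first.
  have := Sl n; have := Np N (leqnn N); rewrite /= ltr_norml => /andP[_]; lra.
rewrite /S -(subnKC Nn) !big_split_ord /= [leRHS]addrC addKr [X in X + _ <=
  _]big1 ?add0r.
  apply: ler_sum => i _; rewrite ltnNge leq_addr /= ler_piMr ?sqr_ge0 //.
  by case: (p _).
by move=> i _; rewrite ltn_ord normc0 expr0n mul0r.
Qed.

End HilbertSpace.

(** * Diagonal operators *)

Section LinearMaps.
Variables (R : realType) (H : completeNormedModType R[i]).
Implicit Types (T : H -> H) (x y : H).

Lemma lin0 T : linear T -> T 0 = 0.
Proof. by move=> lT; have := lT (-1) 0 0;
  rewrite scaler0 addr0 scaleN1r addNr. Qed.

Lemma linZ T a x : linear T -> T (a *: x) = a *: T x.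
Proof. by move=> lT; have := lT a x 0; rewrite (lin0 lT) !addr0. Qed.

Lemma linD T x y : linear T -> T (x + y) = T x + T y.
Proof. by move=> lT; have := lT 1 x y; rewrite !scale1r. Qed.

Lemma linB T x y : linear T -> T (x - y) = T x - T y.
Proof. by move=> lT; rewrite addrC -scaleN1r lT scaleN1r addrC. Qed.

Lemma lin_sum T n (P : pred 'I_n) (F : 'I_n -> H) : linear T ->
  T (\sum_(i < n | P i) F i) = \sum_(i < n | P i) T (F i).
Proof.
move=> lT; apply: (big_morph T) => [x y|]; first exact: linD.
exact: lin0.
Qed.

End LinearMaps.

Section DiagonalOperators.
Variables (R : realType) (H : completeNormedModType R[i]).
Variable dot : {dot H for (@conjC R[i])}.
Hypothesis norm_dot : forall x : H, `|x| ^+ 2 = dot x x.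
Implicit Types (x y z u v w : H) (p q : pred nat) (c : nat -> R)
  (e f : nat -> H) (X : H -> H) (B : R).

Lemma bounded_operatorP X B : linear X -> (forall x, nr (X x) <= B * nr x) ->
  bounded_operator X.
Proof.
move=> lX XB; split=> // x; apply/cvg_nrP => eps eps0.
have B0 : 0 < `|B| + 1 by rewrite ltr_wpDl.
have d0 : 0 < eps / (`|B| + 1) by rewrite divr_gt0.
have /cvg_nrP/(_ _ d0) : id y @[y --> x] --> x by exact: cvg_id.
apply: filterS => y; rewrite ltr_pdivlMr // mulrC; apply: le_lt_trans.
rewrite -linB // (le_trans (XB _)) // ler_wpM2r ?nr_ge0 //.
by rewrite (le_trans (ler_norm B)) // lerDl.
Qed.

(** The operator [\sum_n c_n <., e_n> f_n], as a pointwise limit in norm. *)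
Definition is_diag X c e f :=
  forall x, ncvg (fun N => \sum_(i < N) ((c i)%:C * dot x (e i)) *: f i) (X x).

Lemma diag_coef_le q e c B x N : onsys dot q e -> (forall n, `|c n| <= B) ->
  \sum_(i < N) normc ((c i)%:C * dot x (e i)) ^+ 2 <= (B * nr x) ^+ 2.
Proof.
move=> one cB; rewrite exprMn.
apply: le_trans (ler_wpM2l (sqr_ge0 B) (bessel norm_dot N x one)).
rewrite mulr_sumr; apply: ler_sum => i _; rewrite normcM normc_real exprMn.
by rewrite ler_wpM2r ?sqr_ge0 // ler_sqr ?nnegrE // (le_trans _ (cB i)).
Qed.

Lemma diag_exists q p e f c B : onsys dot q e -> onsys dot p f ->
  (forall n, `|c n| <= B) -> exists X, is_diag X c e f.
Proof.
move=> one onf cB; suff h x : exists v,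
    ncvg (fun N => \sum_(i < N) ((c i)%:C * dot x (e i)) *: f i) v.
  by have [X Xp] := choice h; exists X.
exact: (onsys_series norm_dot (c := fun i => (c i)%:C * dot x (e i)) onf
  (fun N => diag_coef_le x N one cB)).
Qed.

Lemma diag_uniq X Y c e f : is_diag X c e f -> is_diag Y c e f -> X = Y.
Proof. by move=> dX dY; apply/funext => x; exact: (ncvg_uniq (dX x) (dY x)).
Qed.

Lemma diag_linear X c e f : is_diag X c e f -> linear X.
Proof.
move=> dX a u v; apply: (ncvg_uniq (dX _)).
under eq_fun => N.
  rewrite (_ : \sum_(i < N) _ =
    a *: (\sum_(i < N) ((c i)%:C * dot u (e i)) *: f i) +
    \sum_(i < N) ((c i)%:C * dot v (e i)) *: f i); first over.
  rewrite scaler_sumr -big_split /=; apply: eq_bigr => i _.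
  by rewrite dotDl dotZl scalerA -scalerDl; congr (_ *: _); ring.
exact: ncvg_comb.
Qed.

Lemma diag_bound q p e f c B X x : onsys dot q e -> onsys dot p f ->
  0 <= B -> (forall n, `|c n| <= B) -> is_diag X c e f -> nr (X x) <= B * nr x.
Proof.
move=> one onf B0 cB dX; apply: (ncvg_nr_le (dX x)) => N.
rewrite -ler_sqr ?nnegrE ?mulr_ge0 ?nr_ge0 //.
rewrite (onsys_nr_sum norm_dot (fun i => (c i)%:C * dot x (e i)) _ onf).
apply: le_trans (diag_coef_le x N one cB); apply: ler_sum => i _.
by rewrite ler_piMr ?sqr_ge0 //; case: (p i).
Qed.

Lemma diag_bounded q p e f c B X : onsys dot q e -> onsys dot p f ->
  (forall n, `|c n| <= B) -> is_diag X c e f -> bounded_operator X.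
Proof.
move=> one onf cB dX; have B0 : 0 <= B by exact: le_trans (cB 0%N).
by apply: (@bounded_operatorP _ B (diag_linear dX)) => x; exact: diag_bound dX.
Qed.

Lemma diag_dot p e f c X x n : onsys dot p f -> is_diag X c e f ->
  dot (X x) (f n) = (c n)%:C * dot x (e n) * (p n)%:R.
Proof.
move=> onf dX; apply: (ncvg_dot_eq norm_dot (N := n.+1) (dX x)) => N nN.
by rewrite (onsys_dot_sum (fun i => (c i)%:C * dot x (e i)) _ _ onf) nN.
Qed.

Lemma ncvg_eventually s v w M : ncvg s v ->
  (forall n, (M <= n)%N -> s n = w) -> v = w.
Proof.
move=> sv sw; apply: (ncvg_uniq sv); apply/ncvgP => eps eps0;
  exists M => n /sw ->.
by rewrite subrr nr0.
Qed.

Lemma diag_at q e f c X n : onsys dot q e -> is_diag X c e f ->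
  X (e n) = ((c n)%:C * (q n)%:R) *: f n.
Proof.
move=> one dX; apply: (ncvg_eventually (M := n.+1) (dX _)) => N nN.
rewrite (bigD1 (Ordinal nN)) //= one eqxx /= big1 ?addr0 // => i.
rewrite -val_eqE /= eq_sym => /negbTE ni.
by rewrite one ni mulr0 scale0r.
Qed.

Lemma diag_adjoint c e f X A : is_diag X c e f -> is_diag A c f e ->
  forall x y, dot (X x) y = dot x (A y).
Proof.
move=> dX dA x y; apply/eqP; rewrite -subr_eq0 -normc_eq0; apply/eqP.
apply: small_eq0; rewrite ?normc_ge0 // => eps eps0.
pose D := nr x + nr y + 1.
have D0 : 0 < D by rewrite ltr_wpDl ?addr_ge0 ?nr_ge0.
have d0 : 0 < eps / D by rewrite divr_gt0.
have /ncvgP/(_ _ d0)[N hN] := dX x; have /ncvgP/(_ _ d0)[M hM] := dA y.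
pose n := maxn N M; move: (hN n (leq_maxl _ _)) (hM n (leq_maxr _ _)).
set s := \sum_(i < n) _; set t := \sum_(i < n) _ => hs ht.
have st : dot s y = dot x t.
  rewrite /s /t (dotC dot x) !dot_suml rmorph_sum /=; apply: eq_bigr => i _.
  rewrite !dotZl !rmorphM /= conj_real -!dotC; ring.
have -> : dot (X x) y - dot x (A y) = dot (X x - s) y + dot x (t - A y).
  by rewrite dotBl dotBr -st; ring.
rewrite (le_trans (le_normcD _ _)) //.
apply: (@le_trans _ _ (eps / D * nr y + nr x * (eps / D))).
  apply: lerD; apply: (le_trans (cauchy_schwarz norm_dot _ _)).
    by rewrite ler_wpM2r ?nr_ge0 // nrBC ltW.
  by rewrite ler_wpM2l ?nr_ge0 // ltW.
rewrite [X in X + _]mulrC -mulrDl mulrA ler_pdivrMr // mulrC ler_wpM2l ?ltW //.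
by rewrite /D; lra.
Qed.

(** A bounded real function converges along an ultrafilter, because a closed interval is compact. *)
Lemma ultra_real_near (F : set_system H) (g : H -> R) B (d : R) :
  UltraFilter F -> F [set y | `|g y| <= B] -> 0 < d ->
  exists a, F [set y | `|g y - a| < d].
Proof.
move=> UF FB d0; have : (g @ F) `[- B, B]%classic.
  by apply: filterS FB => y gB; rewrite /= in_itv /= -ler_norml; exact: gB.
move=> /(@segment_compact _ (- B) B (g @ F) _)[a [_ cla]].
exists a; have [//|FN] := in_ultra_setVsetC [set y | `|g y - a| < d] UF.
have /(cla [set r | ~ (`|r - a| < d)]) : nbhs a (ball a d)
  by exact: nbhsx_ballx.
case; first exact: FN.
by move=> r [/= rd]; rewrite -ball_normE /= distrC.
Qed.

(** Deleting the first [N] coordinates of [X x] amounts to replacing the first [N] coefficients by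
    0. *)
Lemma diag_tail q p e f c B N X x : onsys dot q e -> onsys dot p f -> 0 <= B ->
  (forall n, (N <= n)%N -> `|c n| <= B) -> is_diag X c e f ->
  nr (X x - onproj dot f N (X x)) <= B * nr x.
Proof.
move=> one onf B0 cB dX; pose c' n := if (n < N)%N then 0 else c n.
have c'B n : `|c' n| <= B.
  by rewrite /c'; case: ltnP => [_|/cB //]; rewrite normr0.
suff dX' : is_diag (fun x => X x - onproj dot f N (X x)) c' e f.
  exact: (diag_bound x one onf B0 c'B dX').
move=> {}x; have -> : onproj dot f N (X x) =
    \sum_(i < N) ((c i)%:C * dot x (e i)) *: f i.
  apply: eq_bigr => i _; rewrite (diag_dot _ _ onf dX).
  have [pi|pi] := boolP (p i); first by rewrite mulr1.
  by rewrite (onsys_out norm_dot onf pi) !scaler0.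
move/ncvgP: (dX x) => cX; apply/ncvgP => eps /cX[M Mp]; exists (maxn N M) => n.
rewrite geq_max => /andP[Nn /Mp]; congr (nr _ < _).
rewrite opprD opprK addrCA addrC.
congr (_ - _).
rewrite -(subnKC Nn) !big_split_ord /= [X in X + _ + _]big1.
  rewrite add0r addrC; congr (_ + _); apply: eq_bigr => i _.
  by rewrite /c' ltnNge leq_addr.
by move=> i _; rewrite /c' ltn_ord mul0r scale0r.
Qed.

(** An ultrafilter on the closed image of the unit ball is Cauchy: each coordinate converges along
    it, and [diag_tail] makes all but finitely many uniformly negligible. *)
Lemma diag_compact q p e f c X : onsys dot q e -> onsys dot p f ->
  (forall eps, 0 < eps -> exists N, forall n, (N <= n)%N -> `|c n| <= eps) ->
  (exists B, forall n, `|c n| <= B) -> is_diag X c e f -> compact_operator X.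
Proof.
move=> one onf c0 [B cB] dX; split; first exact: diag_linear dX.
have B0 : 0 <= B by exact: le_trans (cB 0%N).
set K := X @` _; rewrite precompactE compact_ultra => F UF FK.
have appr y (d : R) : closure K y -> 0 < d ->
    exists x, nr x <= 1 /\ nr (y - X x) < d.
  move=> /(_ (ball y (d%:C))) + d0; have dC : 0 < d%:C by rewrite ltcR.
  move=> /(_ (nbhsx_ballx _ _ dC))[_ [[x /= x1 <-]]].
  by rewrite -ball_normE /= nrE ltcR => h; exists x; rewrite -norm_le1.
have clB y : closure K y -> nr y <= B + 1.
  move=> /appr/(_ ltr01)[x [x1 xy]]; have := nrB_ge y (X x).
  have := diag_bound x one onf B0 cB dX.
  have : B * nr x <= B by rewrite ler_piMr.
  lra.
have coord n (d : R) : 0 < d ->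
    exists a, F [set y | normc (dot y (f n) - a) < d].
  move=> d0; have d2 : 0 < d / 2 by lra.
  have fn1 : nr (f n) <= 1 by rewrite (onsys_nr norm_dot _ onf); case: (p n).
  have nd y : closure K y -> normc (dot y (f n)) <= B + 1.
    move=> /clB; apply: le_trans;
      rewrite (le_trans (cauchy_schwarz norm_dot _ _)) //.
    by rewrite ler_piMr ?nr_ge0.
  have [|a Fa] := @ultra_real_near F (fun y =>
    complex.Re (dot y (f n))) (B + 1) _ UF _ d2.
    by apply: filterS FK => y /nd; apply: le_trans; exact: abs_Re_le.
  have [|b Fb] := @ultra_real_near F (fun y =>
    complex.Im (dot y (f n))) (B + 1) _ UF _ d2.
    by apply: filterS FK => y /nd; apply: le_trans; exact: abs_Im_le.
  exists (Complex a b); apply: filterS2 Fa Fb => y; rewrite /mkset.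
  case: (dot y (f n)) => r s ra sb; rewrite /= in ra sb.
  have -> : Complex r s - Complex a b = Complex (r - a) 0 + Complex 0 (s - b).
    by rewrite /= -[RHS]/(Complex _ _) addr0 add0r.
  apply: (le_lt_trans (le_normcD _ _)).
  rewrite /normc /= !expr0n /= addr0 add0r !sqrtr_sqr; lra.
have Fc : cauchy F.
  apply: cauchy_exP => z /pos_realC[eps eps0 ->].
  have e3 : 0 < eps / 3 by lra.
  have [N Np] := c0 _ e3.
  have dN : 0 < eps / 3 / N.+1%:R by rewrite divr_gt0.
  have [a ap] := choice (fun n => coord n _ dN).
  (* One third of [eps] bounds the tail of [X x], one the distance from [y] to [X x], and one the
     error in the first [N] coordinates. *)
  exists (\sum_(i < N) a i *: f i).
  pose A i := [set y | normc (dot y (f i) - a i) < eps / 3 / N.+1%:R].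
  have FN : F [set y | forall i : 'I_N, A i y].
    by apply: (@filter_forall _ 'I_N (fun i => A i) F) => i; exact: ap.
  apply: filterS2 FK FN => y /appr/(_ e3)[x [x1 yx]] ya.
  rewrite -ball_normE /= nrE ltcR nrBC.
  have h1 : nr (y - onproj dot f N y) < eps / 3 + eps / 3.
    have -> : y - onproj dot f N y = (X x - onproj dot f N (X x)) +
        ((y - X x) - onproj dot f N (y - X x)).
      rewrite /onproj; have -> : \sum_(i < N) dot (y - X x) (f i) *: f i =
        \sum_(i < N) dot y (f i) *: f i - \sum_(i < N) dot (X x) (f i) *: f i.
        by rewrite -sumrB; apply: eq_bigr => i _; rewrite dotBl scalerBl.
      by rewrite opprB addrACA addKr (addrC (X x)) subrK.
    apply: (le_lt_trans (nrD _ _)); apply: ler_ltD.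
      apply: (le_trans (diag_tail x one onf (ltW e3) Np dX)).
      by rewrite ler_piMr // ltW.
    exact: le_lt_trans (nr_onprojB norm_dot N _ onf) yx.
  apply: (le_lt_trans (nr_triangle (onproj dot f N y) _ _)).
  have h2 : nr (onproj dot f N y - \sum_(i < N) a i *: f i) <= eps / 3.
    rewrite /onproj -sumrB (le_trans (nr_sum _)) //.
    apply: (@le_trans _ _ (\sum_(i < N) eps / 3 / N.+1%:R)).
      apply: ler_sum => i _; rewrite -scalerBl nrZ (onsys_nr norm_dot _ onf).
      apply: le_trans (ltW (ya i)); rewrite ler_piMr ?normc_ge0 //.
      by case: (p i).
    rewrite sumr_const card_ord -[leLHS]mulr_natr -mulrA ler_piMr ?ltW //.
    by rewrite ltr_pdivrMl // mulr1 ltr_nat.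
  lra.
move/cauchy_cvg : Fc => /cvg_ex[l Fl].
exists l; split => //; apply: (@closed_closure _ K) => V /Fl FV.
by have [y Vy] := filter_ex (filterI FK FV); exists y.
Qed.

End DiagonalOperators.

(** * Schmidt decomposition *)

Lemma inv_natS_small (R : realType) (eps : R) : 0 < eps ->
  exists N, forall n, (N <= n)%N -> n.+1%:R^-1 < eps.
Proof.
move=> eps0; exists (Num.bound eps^-1) => n Nn.
rewrite -[eps]invrK ltf_pV2 ?posrE ?invr_gt0 // (@lt_le_trans _ _ (Num.bound
  eps^-1)%:R) //.
  by rewrite archi_boundP // invr_ge0 ltW.
by rewrite ler_nat; exact: leqW.
Qed.

(** Course-of-values recursion, for choosing vectors orthogonal to all their predecessors. *)
Lemma prefix_rec (T : Type) (g : seq T -> T) :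
  exists e : nat -> T, forall n, e n = g (mkseq e n).
Proof.
pose E := fix E n := if n is m.+1 then rcons (E m) (g (E m)) else [::].
exists (fun n => g (E n)) => n; congr g.
by elim: n => [|n IHn] //=; rewrite mkseqS -IHn.
Qed.

Section Schmidt.
Variables (R : realType) (H : completeNormedModType R[i]).
Variable dot : {dot H for (@conjC R[i])}.
Hypothesis norm_dot : forall x : H, `|x| ^+ 2 = dot x x.
Implicit Types (x y z u v w : H) (p q : pred nat) (s : nat -> R)
  (e f : nat -> H) (X : H -> H) (B : R) (L : seq H).

Lemma compact_cluster X (x_ : nat -> H) : compact_operator X ->
    (forall n, nr (x_ n) <= 1) ->
  exists y, forall eps : R, 0 < eps -> forall N,
    exists2 n, (N <= n)%N & nr (X (x_ n) - y) < eps.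
Proof.
move=> [_]; rewrite precompactE; set K := X @` _ => cK x1.
have : ((fun n => X (x_ n)) @ \oo) (closure K).
  exists 0%N => // n _; apply: subset_closure; exists (x_ n) => //=.
  by rewrite norm_le1.
move/cK => [y [_ cly]]; exists y => eps eps0 N.
have epsC : 0 < eps%:C by rewrite ltcR.
have [|_ [[n Nn <-]]] := cly [set X (x_ n) | n in [set n | (N <= n)%N]] _ _
  (nbhsx_ballx y _ epsC).
  by exists N => // n /= Nn; exists n.
by rewrite -ball_normE /= nrE ltcR nrBC; exists n.
Qed.

Definition perp L x := forall y, y \in L -> dot x y = 0.

Lemma perp0 L : perp L 0.
Proof. by move=> y _; rewrite dot0l. Qed.

Lemma perpZ a L x : perp L x -> perp L (a *: x).
Proof. by move=> Lx y /Lx yx; rewrite dotZl yx mulr0. Qed.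

Lemma perpD L x y : perp L x -> perp L y -> perp L (x + y).
Proof. by move=> Lx Ly z zL; rewrite dotDl Lx // Ly // addr0. Qed.

Lemma bound_from_ball X L B : linear X ->
    (forall x, perp L x -> nr x <= 1 -> nr (X x) <= B) ->
  forall x, perp L x -> nr (X x) <= B * nr x.
Proof.
move=> lX XB x Lx; have [->|x0] := eqVneq x 0.
  by rewrite lin0 // nr0 mulr0.
have nx0 : 0 < nr x by rewrite lt_def nr_eq0 x0 nr_ge0.
have : nr (X ((nr x)^-1%:C *: x)) <= B.
  apply: XB; first exact: perpZ.
  by rewrite nrZ normc_real ger0_norm ?invr_ge0 ?nr_ge0 // mulVf ?gt_eqF.
rewrite linZ // nrZ normc_real ger0_norm ?invr_ge0 ?nr_ge0 //.
by rewrite ler_pdivrMl // mulrC.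
Qed.

(** Otherwise the unit ball would contain vectors [x_ n] with [n < nr (X (x_ n))], whose images
    cannot cluster. *)
Lemma compact_operator_bound X : compact_operator X ->
  exists2 B, 0 <= B & forall x, nr (X x) <= B * nr x.
Proof.
move=> cX; have lX : linear X by case: cX.
suff [B hB] : exists B, forall x, nr x <= 1 -> nr (X x) <= B.
  exists B; first by have := hB 0; rewrite lin0 // !nr0; apply.
  move=> x; apply: (@bound_from_ball X [::]) => //; first by move=> y _;
    exact: hB.
apply: contrapT => /forallNP h.
have [x_ x_p] : {x_ : nat -> H &
    forall n, nr (x_ n) <= 1 /\ n%:R < nr (X (x_ n))}.
  apply: (@choice _ _ (fun n x => nr x <= 1 /\ n%:R < nr (X x))) => n.
  have /existsNP[x /not_implyP[x1 /negP]] := h n%:R.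
  by rewrite -ltNge => nx; exists x.
have [y yp] := compact_cluster cX (fun n => (x_p n).1).
have [n yn] := yp 1 ltr01 (Num.bound (nr y + 1)).
have := (x_p n).2; have := nrB_ge (X (x_ n)) y.
have := archi_boundP (addr_ge0 (nr_ge0 y) (@ler01 R)).
have : (Num.bound (nr y + 1))%:R <= n%:R :> R by rewrite ler_nat.
lra.
Qed.

(* Near-maximising sequences are Cauchy by the parallelogram law once their
   images converge, so no adjoint is needed to find a maximiser. *)
Lemma maximizer X L : compact_operator X ->
  exists v, [/\ perp L v, nr v = (0 < nr (X v))%R%:R
    & forall x, perp L x -> nr (X x) <= nr (X v) * nr x].
Proof.
move=> cX; have lX : linear X by case: cX.
have [B B0 XB] := compact_operator_bound cX.
pose A := [set nr (X x) | x in [set x | perp L x /\ nr x <= 1]].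
have A0 : A 0.
  exists 0; last by rewrite lin0 // nr0.
  by split; [exact: perp0|rewrite nr0].
have supA : has_sup A.
  split; first by exists 0.
  exists B => _ [x [_ x1] <-]; rewrite (le_trans (XB x)) //.
  by rewrite ler_piMr.
pose l := sup A.
have leA x : perp L x -> nr x <= 1 -> nr (X x) <= l.
  by move=> Lx x1; apply: (sup_upper_bound supA); exists x.
have lel := bound_from_ball lX leA.
have l0 : 0 <= l by apply: (sup_upper_bound supA).
(* If [X] vanishes on the complement of [L], the maximizer is the zero vector, as the prescribed
   norm demands. *)
have [le0|lgt0] := leP l 0.
  exists 0; rewrite lin0 // nr0 ltxx; split => //; first exact: perp0.
  move=> x Lx; rewrite mul0r (le_trans (lel x Lx)) //.
  by rewrite mulr_le0_ge0 // nr_ge0.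
have [x_ x_p] : {x_ : nat -> H & forall n,
    [/\ perp L (x_ n), nr (x_ n) <= 1 & l - n.+1%:R^-1 < nr (X (x_ n))]}.
  apply: (@choice _ _ (fun n x =>
    [/\ perp L x, nr x <= 1 & l - n.+1%:R^-1 < nr (X x)])) => n.
  have n0 : 0 < n.+1%:R^-1 :> R by rewrite invr_gt0.
  by have [_ [x [Lx x1] <-] h] := sup_adherent n0 supA; exists x.
have [y yp] := @compact_cluster X x_ cX (fun n => let: And3 _ h _ :=
  x_p n in h).
have [z_ z_p] : {z_ : nat -> H & forall n, [/\ perp L (z_ n), nr (z_ n) <= 1,
    l - n.+1%:R^-1 < nr (X (z_ n)) & nr (X (z_ n) - y) < n.+1%:R^-1]}.
  apply: (@choice _ _ (fun n z => [/\ perp L z, nr z <= 1,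
    l - n.+1%:R^-1 < nr (X z) & nr (X z - y) < n.+1%:R^-1])) => n.
  have n0 : 0 < n.+1%:R^-1 :> R by rewrite invr_gt0.
  have [m nm xm] := yp _ n0 n; exists (x_ m); have [h1 h2 h3] := x_p m.
  split => //; apply: le_lt_trans h3; rewrite lerD2l lerN2.
  by rewrite lef_pV2 ?posrE // ler_nat.
have [v zv] : exists v, ncvg z_ v.
  apply: cauchy_conv => eps eps0.
  (* With [t = 1 / (N + 1)], near-maximality gives [l * S > 2 * l - 4 * t], and
     [S ^ 2 >= 4 * S - 4]; the parallelogram law then bounds [l * nr (z_ N - z_ n) ^ 2] by
     [16 * t]. *)
  have d0 : 0 < eps ^+ 2 * l / 16 by rewrite divr_gt0 // mulr_gt0 // exprn_gt0.
  have [N Np] := inv_natS_small d0; exists N => n Nn.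
  have h := Np N (leqnn N); have hn : n.+1%:R^-1 <= N.+1%:R^-1 :> R.
    by rewrite lef_pV2 ?posrE // ler_nat.
  have [LN zN1 XN yN] := z_p N; have [Ln zn1 Xn yn] := z_p n.
  move: (N.+1%:R^-1) h hn XN yN => t h hn XN yN.
  move: (n.+1%:R^-1) hn Xn yn => r hn Xn yn.
  rewrite -ltr_sqr ?nnegrE ?nr_ge0 ?(ltW eps0) // (parallelogram norm_dot).
  set S := nr (z_ N + z_ n).
  have sq1 x : nr x <= 1 -> nr x ^+ 2 <= 1.
    by move=> x1; rewrite -(expr1n _ 2) ler_sqr ?nnegrE ?nr_ge0.
  have := sq1 _ zN1; have := sq1 _ zn1.
  have S2 : 4 * S - 4 <= S ^+ 2 by have := sqr_ge0 (S - 2); rewrite sqrrB; lra.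
  have lS : 2 * l - 4 * t < l * S.
    apply: lt_le_trans (lel _ (perpD LN Ln)).
    rewrite linD //; have -> : X (z_ N) + X (z_ n) =
        (X (z_ N) + X (z_ N)) - (X (z_ N) - X (z_ n)).
      by rewrite opprB addrACA subrr addr0 addrC.
    apply: lt_le_trans (nrB_ge _ _).
    have -> : nr (X (z_ N) + X (z_ N)) = 2 * nr (X (z_ N)).
      by rewrite -mulr2n -scaler_nat nrZ -(rmorph_nat (real_complex R))
        normc_real normr_nat.
    have := nr_triangle y (X (z_ N)) (X (z_ n)); rewrite (nrBC y); lra.
  have : 16 * t < eps ^+ 2 * l by rewrite mulrC -ltr_pdivlMr.
  move=> h16 a1 a2.
  rewrite -(ltr_pM2r lgt0).
  have : S ^+ 2 * l >= (4 * S - 4) * l by rewrite ler_wpM2r.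
  have : nr (z_ N) ^+ 2 * l <= 1 * l by rewrite ler_wpM2r.
  have : nr (z_ n) ^+ 2 * l <= 1 * l by rewrite ler_wpM2r.
  lra.
have v1 : nr v <= 1 by apply: (ncvg_nr_le zv) => n; case: (z_p n).
have Lv : perp L v.
  move=> w wL; apply: (ncvg_dot_eq norm_dot (N := 0%N) zv) => n _.
  by case: (z_p n) => /(_ w wL).
have Xzv : ncvg (fun n => X (z_ n)) (X v).
  by apply: (ncvg_lipschitz (C := B)) => // a b; rewrite -linB.
have lv : l <= nr (X v).
  rewrite leNgt; apply/negP => vl; have d0 : 0 < (l - nr (X v)) / 2 by lra.
  have [N1 h1] := inv_natS_small d0.
  move/ncvgP : Xzv => /(_ _ d0)[N2 h2].
  have := h1 _ (leq_maxl N1 N2); have := h2 _ (leq_maxr N1 N2).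
  have [_ _ h3 _] := z_p (maxn N1 N2).
  move: (_.+1%:R^-1) h3 => r h3.
  have := nrB_ge (X (z_ (maxn N1 N2))) (X v); lra.
have vl := lel v Lv.
have lv1 : nr v = 1.
  apply/eqP; rewrite eq_le v1 /= -(ler_pM2l lgt0) mulr1; exact: le_trans vl.
have Xvl : nr (X v) = l.
  by apply/eqP; rewrite eq_le lv andbT (le_trans vl) // lv1 mulr1.
by exists v; rewrite lv1 Xvl lgt0; split.
Qed.

(** First variation: passing from [v] to [v + T *: u] with [T = t * w^*] raises [nr (X _) ^ 2] by at
    least [2 * t * W], but [nr _ ^ 2] only by [t ^ 2 * W * nr u ^ 2]. For this [t], maximality
    forces [W = 0]. *)
Lemma maximizer_orth X L v u : linear X -> perp L v -> perp L u -> nr v = 1 ->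
    (forall x, perp L x -> nr (X x) <= nr (X v) * nr x) ->
  dot u v = 0 -> dot (X u) (X v) = 0.
Proof.
move=> lX Lv Lu v1 vmax uv; set w := dot (X u) (X v).
pose W := normc w ^+ 2; pose C := nr (X v) ^+ 2 * nr u ^+ 2.
have C0 : 0 <= C by rewrite mulr_ge0 ?sqr_ge0.
suff W0 : W <= 0.
  apply/eqP; rewrite -normc_eq0 -sqrf_eq0 eq_le W0 sqr_ge0 //.
pose t := (C + 1)^-1; have t0 : 0 < t by rewrite invr_gt0 ltr_wpDl.
pose T : R[i] := t%:C * w^*.
have nT : normc T ^+ 2 = t ^+ 2 * W.
  by rewrite /T normcM normc_real normc_conj exprMn real_normK ?num_real.
have := vmax _ (perpD Lv (perpZ T Lu)).
rewrite -(@ler_sqr _ (nr (X _))) ?nnegrE ?mulr_ge0 ?nr_ge0 // exprMn.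
rewrite (@nrD_orth _ _ _ norm_dot v (T *: u)); last first.
  by rewrite dotZr (dot_eq0C uv) mulr0.
rewrite linD // linZ // (nrD_sq norm_dot) !nrZ !exprMn nT v1 expr1n.
have -> : dot (X v) (T *: X u) = (t * W)%:C.
  rewrite dotZr (dotC dot (X v)) -/w.
  have -> : T^* = t%:C * w by rewrite /T rmorphM /= conj_real conjCK.
  by rewrite -mulrA normc_sqE -rmorphM.
move=> /= h.
have {}h : 2 * t * W <= t * (t * C) * W.
  have : 0 <= t ^+ 2 * W * nr (X u) ^+ 2.
    by rewrite mulr_ge0 ?sqr_ge0 // mulr_ge0 ?sqr_ge0.
  by move: h; rewrite /C; lra.
have tC : t * C <= 1.
  by rewrite /t ler_pdivrMl ?mulr1 ?lerDl // ltr_wpDl.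
have W0 : 0 <= W by exact: sqr_ge0.
have : t * (t * C) * W <= t * W.
  by rewrite ler_wpM2r // ler_piMr // ltW.
move=> h2; have : t * W <= 0 by lra.
by rewrite pmulr_rle0.
Qed.

(** [onsys] makes the vectors with [s n = 0] vanish, which covers operators of finite rank. *)
Definition schmidt X s e f :=
  [/\ c0star s, onsys dot (fun n => 0 < s n) e,
     onsys dot (fun n => 0 < s n) f & is_diag dot X s e f].

(** Each [e n] maximizes [nr (X _)] on the orthogonal complement of its predecessors, with maximum
    [s n]. The images are orthogonal by [maximizer_orth]; normalized, they give [f]. The remainder
    [x - onproj dot e n x] is orthogonal to the first [n] vectors, so its image has norm at most
    [s n * nr x]. *)
Theorem schmidt_decomposition X : compact_operator X ->
  exists s e f, schmidt X s e f.
Proof.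
move=> cX; have lX : linear X by case: cX.
have [g gp] := choice (fun L => maximizer L cX).
have [e ep] := prefix_rec g.
pose s n := nr (X (e n)).
have perpE n x : perp (mkseq e n) x <-> forall m, (m < n)%N -> dot x (e m) = 0.
  split=> [Lx m mn|h y /mapP[m]]; first by apply: Lx; apply/mapP; exists m;
    rewrite ?mem_iota.
  by rewrite mem_iota => /andP[_ mn] ->; exact: h.
have ne n : nr (e n) = (0 < s n)%R%:R by rewrite /s ep; case: (gp (mkseq e n)).
have Le n : perp (mkseq e n) (e n) by rewrite ep; case: (gp (mkseq e n)).
have max n x : perp (mkseq e n) x -> nr (X x) <= s n * nr x.
  by rewrite /s ep; case: (gp (mkseq e n)) => _ _; apply.
have s0 n : 0 <= s n by exact: nr_ge0.
have one : onsys dot (fun n => 0 < s n) e.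
  move=> m n; case: (ltngtP m n) => mn /=.
  - by apply: dot_eq0C; exact: (perpE n (e n)).1 (Le n) _ mn.
  - exact: (perpE m (e m)).1 (Le m) _ mn.
  - by rewrite mn (dotxx norm_dot) ne; case: (0 < s n); rewrite ?expr1n ?expr0n.
have snd : nonincreasing_seq s.
  apply/nonincreasing_seqP => n; apply: (@le_trans _ _ (s n * nr (e n.+1))).
    by apply: max; apply/perpE => m mn;
      apply: (perpE _ _).1 (Le n.+1) _ (ltnW mn).
  by rewrite ne ler_piMr //; case: (0 < s n.+1).
have Xorth m n : (m < n)%N -> dot (X (e n)) (X (e m)) = 0.
  move=> mn; have [sm|] := ltP 0 (s m); last first.
    by rewrite /s => h; have /eqP -> : X (e m) == 0;
      rewrite ?dot0r // -nr_eq0 eq_le h nr_ge0.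
  apply: (@maximizer_orth X (mkseq e m)) => //.
  - apply/perpE => k km; apply: (perpE _ _).1 (Le n) _ (ltn_trans km mn).
  - by rewrite ne sm.
  - by move=> x /max.
  - exact: (perpE _ _).1 (Le n) _ mn.
have sc : s @ \oo --> (0 : R).
  (* Otherwise the images of the [e n] would be orthogonal of norm at least [eps], hence too far
     apart to cluster. *)
  have small eps : 0 < eps -> exists n, s n < eps.
    move=> eps0; apply: contrapT => /forallNP h.
    have sge n : eps <= s n by rewrite leNgt; apply/negP.
    have e1 n : nr (e n) <= 1 by rewrite ne; case: (0 < s n).
    have [y yp] := compact_cluster cX e1.
    have d0 : 0 < eps / 2 by lra.
    have [n _ yn] := yp _ d0 0%N; have [m nm ym] := yp _ d0 n.+1.
    have : nr (X (e m) - X (e n)) < eps.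
      by apply: le_lt_trans (nr_triangle y _ _) _; rewrite (nrBC y); lra.
    rewrite -ltr_sqr ?nnegrE ?nr_ge0 ?(ltW eps0) // ltNge => /negP; apply.
    rewrite (nrD_orth norm_dot) ?nrN; last first.
      by rewrite linearNr /= Xorth ?oppr0.
    have : eps ^+ 2 <= nr (X (e m)) ^+ 2.
      by rewrite ler_sqr ?nnegrE ?nr_ge0 ?(ltW eps0) // sge.
    by have := sqr_ge0 (nr (X (e n))); lra.
  apply/cvgrPdist_lt => eps eps0; have [N sN] := small _ eps0;
    exists N => // n /= Nn.
  rewrite sub0r normrN ger0_norm //; exact: le_lt_trans (snd _ _ Nn) sN.
have cs : c0star s by [].
(* Where [s n = 0] the inverse is 0 by convention, so [f n = 0], as [onsys] requires. *)
pose f n := (s n)^-1%:C *: X (e n).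
have sf n : (s n)%:C *: f n = X (e n).
  rewrite /f scalerA -rmorphM /=; have [sn|sn] := eqVneq (s n) 0.
    by rewrite sn mul0r scale0r; apply/esym/eqP; rewrite -nr_eq0 -/(s n) sn.
  by rewrite divff // scale1r.
have onf : onsys dot (fun n => 0 < s n) f.
  move=> m n; rewrite /f dotZl dotZr; case: (ltngtP m n) => mn /=.
  - by rewrite (dot_eq0C (Xorth _ _ mn)) !mulr0.
  - by rewrite Xorth // !mulr0.
  - rewrite mn (dotxx norm_dot) -/(s n) conj_real -!rmorphM /=.
    rewrite lt_def s0 andbT; have [sn|sn] := eqVneq (s n) 0.
      by rewrite sn invr0 !mul0r.
    by rewrite (_ : _ * _ = 1) //; field.
clearbody f; exists s, e, f; split => // x.
apply: (@ncvg_squeeze _ _ _ _ (fun n => s n * nr x)) => [n|]; last first.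
  by rewrite -(mul0r (nr x)); apply: cvgM => //; exact: cvg_cst.
have -> : \sum_(i < n) ((s i)%:C * dot x (e i)) *: f i = X (onproj dot e n x).
  rewrite /onproj lin_sum //; apply: eq_bigr => i _.
  by rewrite (linZ _ _ lX) -(sf i) scalerA mulrC.
rewrite nrBC -linB //; apply: (@le_trans _ _ (s n * nr (x - onproj dot e n x))).
  by apply: max; apply/perpE => m mn; rewrite (onprojB_dot norm_dot _ one).
by rewrite ler_wpM2l // (nr_onprojB norm_dot _ _ one).
Qed.

End Schmidt.

(** * Singular numbers and characteristic sets *)

Section SingularNumbers.
Variables (R : realType) (H : completeNormedModType R[i]).
Variable dot : {dot H for (@conjC R[i])}.
Hypothesis norm_dot : forall x : H, `|x| ^+ 2 = dot x x.
Implicit Types (x y v w : H) (s z : nat -> R)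
  (e f : nat -> H) (X : H -> H) (B : R) (I : set (H -> H)).

Lemma c0star_abs_le s n : c0star s -> `|s n| <= s 0%N.
Proof. by move=> [s0 sd _]; rewrite ger0_norm //; exact: sd. Qed.

Lemma is_adjoint_uniq X A A' :
  is_adjoint dot X A -> is_adjoint dot X A' -> A = A'.
Proof.
move=> [_ hA] [_ hA']; apply/funext => y; apply: (dot_inj norm_dot) => z.
by rewrite -hA hA'.
Qed.

(** The adjoint [A] is the diagonal operator with [e] and [f] exchanged, so [A (X (e n))] is
    [s n ^ 2] times [e n]. An eigenvector for [l ^ 2] is orthogonal to every [e n] with [s n != l],
    and it is recovered from its image, a finite sum because [s] tends to 0. *)
Lemma schmidt_singular_numbers X s e f :
  schmidt dot X s e f -> singular_numbers dot X s.
Proof.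
move=> [cs one onf dX]; split=> //; have [s0 sd _] := cs.
have sB n := c0star_abs_le n cs.
have [A dA] := diag_exists norm_dot onf one sB.
have bA := diag_bounded norm_dot onf one sB dA.
have lA : linear A by case: bA.
exists A, e; split; first by split => //; exact: (diag_adjoint norm_dot dX dA).
move=> l l0; split.
  by move=> m n _ sn; rewrite one sn l0 andbT.
have AXe n : s n = l -> A (X (e n)) = (l ^+ 2)%:C *: e n.
  move=> sn; rewrite (diag_at _ one dX) (linZ _ _ lA) (diag_at _ onf dA)
    scalerA.
  by rewrite sn l0 !mulr1 rmorphXn expr2.
move=> v; split=> [AXv|[N [c ->]]]; last first.
  have lX : linear X := diag_linear dX.
  rewrite (lin_sum _ _ lX) (lin_sum _ _ lA) scaler_sumr.
  apply: eq_bigr => i /eqP si.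
  by rewrite (linZ _ _ lX) (linZ _ _ lA) AXe // !scalerA mulrC.
have [N Np] := c0star_lt cs l0; exists N, (fun n => dot v (e n)).
have l2 : (l ^+ 2)%:C != 0 :> R[i].
  by rewrite -(rmorph0 (real_complex R)) (inj_eq (@complexI R)) expf_eq0 gt_eqF.
have ve n : s n != l -> dot v (e n) = 0.
  move=> sn; have [sn0|sn0] := boolP (0 < s n); last first.
    by rewrite (onsys_dot norm_dot _ one).
  have : dot (A (X v)) (e n) = (s n ^+ 2)%:C * dot v (e n).
    rewrite (diag_dot norm_dot _ _ one dA) (diag_dot norm_dot _ _ onf dX) sn0
      !mulr1.
    by rewrite mulrA -rmorphM expr2.
  rewrite AXv dotZl => /eqP; rewrite -subr_eq0 -mulrBl mulf_eq0 -rmorphB.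
  case/orP => [|/eqP//];
    rewrite -(rmorph0 (real_complex R)) (inj_eq (@complexI R)).
  rewrite subr_eq0 eqrXn2 //; last exact: ltW.
  by rewrite eq_sym (negbTE sn).
suff : A (X v) = (l ^+ 2)%:C *: \sum_(n < N | s n == l) dot v (e n) *: e n.
  by rewrite AXv => /(scalerI l2).
apply: (ncvg_eventually (M := N) (dA _)) => n Nn.
have -> : \sum_(i < n) ((s i)%:C * dot (X v) (f i)) *: e i =
    \sum_(i < n) (if s i == l then (l ^+ 2)%:C *: (dot v (e i) *: e i) else 0).
  apply: eq_bigr => i _; rewrite (diag_dot norm_dot _ _ onf dX).
  case: eqP => [->|/eqP sl]; last by rewrite ve // !(mulr0, mul0r) scale0r.
  by rewrite l0 mulr1 mulrA -rmorphM -expr2 scalerA.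
rewrite -big_mkcond /= scaler_sumr.
rewrite -(subnKC Nn) big_mkcond big_split_ord /= -big_mkcond /=.
rewrite [X in _ + X]big1 ?addr0 // => i _; case: eqP => // sl.
by have := Np (N + i)%N (leq_addr _ _); rewrite sl ltxx.
Qed.

(** If [s' n < s n = l], the eigenspace for [l ^ 2] contains one more orthonormal vector [E i] than
    there are vectors [F m] spanning it. The double sum of [|<E i, F m>| ^ 2], estimated by Bessel
    from both sides, replaces a dimension count. *)
Lemma singular_numbers_step X s s' n :
  singular_numbers dot X s -> singular_numbers dot X s' ->
  (forall i, (i < n)%N -> s i = s' i) -> s n <= s' n.
Proof.
move=> [[s0 sd sl] [A [e [adA eigA]]]]
  [[s0' sd' sl'] [A' [e' [adA' eigA']]]] ss'.
rewrite leNgt; apply/negP => s'n; set l := s n in s'n.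
have l0 : 0 < l by exact: le_lt_trans s'n.
have AA' := is_adjoint_uniq adA' adA; rewrite {}AA' in eigA' adA'.
have [one eig] := eigA l l0; have [one' eig'] := eigA' l l0.
pose E i := if (i < n.+1)%N && (s i == l) then e i else 0.
pose F m := if (m < n)%N && (s' m == l) then e' m else 0.
have onE : onsys dot (fun i => (i < n.+1)%N && (s i == l)) E.
  move=> i j; rewrite /E; case: ifP => [/andP[_ /eqP si]|hi].
    case: ifP => [/andP[_ /eqP sj]|hj]; first by rewrite andbT one.
    by rewrite dot0r andbF.
  rewrite dot0l; case: eqP => // <-; by rewrite hi.
have onF : onsys dot (fun i => (i < n)%N && (s' i == l)) F.
  move=> i j; rewrite /F; case: ifP => [/andP[_ /eqP si]|hi].
    case: ifP => [/andP[_ /eqP sj]|hj]; first by rewrite andbT one'.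
    by rewrite dot0r andbF.
  rewrite dot0l; case: eqP => // <-; by rewrite hi.
(* The eigenvector [e i] is a combination of the [e' m] with [s' m = l], and such [m] are below [n]
   because [s' n < l]. *)
have EF i : onproj dot F n (E i) = E i.
  rewrite /E; case: ifP => [/andP[_ /eqP si]|_]; last first.
    by rewrite /onproj big1 // => j _; rewrite dot0l scale0r.
  have [N [c eic]] : exists (N : nat) (c : nat -> R[i]),
      e i = \sum_(m < N | s' m == l) c m *: e' m.
    apply/eig'/eig; exists i.+1, (fun k => (k == i)%:R).
    rewrite (bigD1 ord_max) ?si //= eqxx scale1r big1 ?addr0 // => k /andP[_].
    by rewrite -val_eqE /= => /negbTE ->; rewrite scale0r.
  have {}eic : e i = \sum_(m < n) (if (m < N)%N then c m else 0) *: F m.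
    rewrite eic big_mkcond /=.
    have s'lt m : (n <= m)%N -> (s' m == l) = false.
      by move=> nm; apply/negbTE; rewrite lt_eqF // (le_lt_trans _ s'n) //;
        exact: sd'.
    rewrite (eq_bigr (fun m : 'I_N => c m *: F m)); last first.
      move=> m _; rewrite /F; have [mn|nm] := ltnP m n.
        by case: eqP => //; rewrite scaler0.
      by rewrite s'lt //= scaler0.
    rewrite -(big_mkord xpredT (fun m => c m *: F m)).
    rewrite -(big_mkord xpredT
      (fun m => (if (m < N)%N then c m else 0) *: F m)).
    pose K := maxn N n.
    rewrite (big_nat_widen _ _ K) ?leq_maxl // [RHS](big_nat_widen _ _ K)
      ?leq_maxr //.
    rewrite big_mkcond [RHS]big_mkcond /=; apply: eq_bigr => m _.
    case: ltnP => mN; case: ltnP => nm //; rewrite ?scale0r //.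
    by rewrite /F ltnNge nm scaler0.
  rewrite /onproj [RHS]eic; apply: eq_bigr => m _; rewrite {1}eic.
  rewrite (onsys_dot_sum (fun m => if (m <
    N)%N then c m else 0) _ _ onF) ltn_ord /=.
  case: (boolP (s' m == l)) => hm; first by rewrite mulr1.
  by rewrite (onsys_out norm_dot onF) ?scaler0 // negb_and hm orbT.
have : \sum_(i < n.+1) (nr (E i)) ^+ 2 <= \sum_(m < n) (nr (F m)) ^+ 2.
  have -> : \sum_(i < n.+1) (nr (E i)) ^+ 2 =
      \sum_(m < n) \sum_(i < n.+1) normc (dot (F m) (E i)) ^+ 2.
    rewrite exchange_big /=; apply: eq_bigr => i _.
    rewrite (bessel_eq norm_dot n _ onF) EF subrr nr0 expr0n add0r.
    by apply: eq_bigr => m _; rewrite dotC normc_conj.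
  by apply: ler_sum => m _; exact: (bessel norm_dot _ _ onE).
rewrite (eq_bigr (fun i : 'I_n.+1 => (s i == l)%:R)); last first.
  by move=> i _; rewrite (onsys_nr norm_dot _ onE) ltn_ord; case: eqP => _;
    rewrite ?expr1n ?expr0n.
rewrite [leRHS](eq_bigr (fun i : 'I_n => (s i == l)%:R)); last first.
  by move=> i _; rewrite (onsys_nr norm_dot _ onF) ltn_ord ss' //;
    case: eqP => _; rewrite ?expr1n ?expr0n.
by rewrite big_ord_recr /= eqxx /=; lra.
Qed.

Lemma singular_numbers_uniq X s s' :
  singular_numbers dot X s -> singular_numbers dot X s' -> s = s'.
Proof.
move=> hs hs'; apply/funext => n; elim/ltn_ind: n => n IHn.
apply/eqP; rewrite eq_le (singular_numbers_step hs hs') //=.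
by apply: (singular_numbers_step hs' hs) => i /IHn.
Qed.

Lemma singular_numbers_schmidt X s : compact_operator X ->
  singular_numbers dot X s -> exists e f, schmidt dot X s e f.
Proof.
move=> cX hs; have [s' [e [f h]]] := schmidt_decomposition norm_dot cX.
by rewrite (singular_numbers_uniq hs (schmidt_singular_numbers h)); exists e, f.
Qed.

(** Where [s n > 0], [V] takes [e n] to [e' n] and [W] takes [f' n] to [(s n / z n) *: f n], so that
    [X = W Z V]. The quotient is at most [C], and it is 0 where [z n = 0]. *)
Lemma ideal_dominated I X Z s z e f e' f' C : is_ideal I -> I Z ->
    schmidt dot X s e f -> schmidt dot Z z e' f' -> 0 < C ->
    (forall n, s n <= C * z n) ->
  I X.
Proof.
move=> idI IZ [[s0 _ _] one onf dX] [[z0 _ _] one' onf' dZ] C0 sz.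
have sz0 n : 0 < s n -> 0 < z n.
  by move=> sn; rewrite -(pmulr_rgt0 _ C0) (lt_le_trans sn).
have abs1 (n : nat) : `|1 : R| <= 1 by rewrite normr1.
have [V dV] := diag_exists norm_dot (c := fun=> 1) one one' abs1.
have szC n : `|s n / z n| <= C.
  rewrite ger0_norm ?divr_ge0 //; have [zn|zn] := ltP 0 (z n).
    by rewrite ler_pdivrMr.
  have -> : z n = 0 by apply/eqP; rewrite eq_le zn z0.
  by rewrite invr0 mulr0 ltW.
have [W dW] := diag_exists norm_dot onf' onf szC.
have bV := diag_bounded norm_dot one one' abs1 dV.
have bW := diag_bounded norm_dot onf' onf szC dW.
suff -> : X = W \o (Z \o V).
  exact: (Defs.idealMl idI bW (Defs.idealMr idI bV IZ)).
apply: (diag_uniq dX) => x.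
have := dW (Z (V x)); congr (ncvg _ _); apply/funext => N.
apply: eq_bigr => i _; rewrite (diag_dot norm_dot _ _ onf' dZ).
rewrite (diag_dot norm_dot _ _ one' dV) rmorph1 mul1r.
have [si|si] := boolP (0 < s i); last first.
  by rewrite (onsys_out norm_dot onf si) !scaler0.
rewrite sz0 //; congr (_ *: _).
have zi : (z i)%:C != 0 :> R[i].
  by rewrite -(rmorph0 (real_complex R)) (inj_eq (@complexI R)) gt_eqF ?sz0.
by rewrite rmorphM fmorphV /=; field.
Qed.

(** Gram-Schmidt: no finite system spans [H], so some [x] differs from its projection, and the
    normalized difference extends the system. *)
Lemma orthonormal_sequence : infinite_dimensional H ->
  exists b : nat -> H, onsys dot xpredT b.
Proof.
move=> infH.
pose ons L := forall i j, (i < size L)%N -> (j < size L)%N ->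
  dot (nth 0 L i) (nth 0 L j) = (i == j)%:R.
(* The condition [ons L] stands under the existential, so that [choice] yields a function on all
   lists. *)
have step (L : seq H) : exists v, ons L -> perp dot L v /\ nr v = 1.
  have [onL|] := pselect (ons L); last by exists 0.
  pose b i := if (i < size L)%N then nth 0 L i else 0.
  have onb : onsys dot (fun i => i < size L)%N b.
    move=> i j; rewrite /b; case: ltnP => hi; last first.
      by rewrite dot0l; case: eqP => // <-; rewrite ltnNge hi.
    by case: ltnP => hj; rewrite ?dot0r ?andbF // andbT onL.
  have /existsNP[x /forallNP xn] := infH (size L) (fun i => b i).
  have x0 : x - onproj dot b (size L) x != 0.
    by rewrite subr_eq0; apply/eqP => h; apply: (xn (fun i => dot x (b i))).
  set y := x - _ in x0; have ny : nr y != 0 by rewrite nr_eq0.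
  exists ((nr y)^-1%:C *: y) => _; split.
    apply: perpZ => w /(nthP 0)[i iL <-].
    by have := onprojB_dot norm_dot x onb iL; rewrite /b iL.
  by rewrite nrZ normc_real ger0_norm ?invr_ge0 ?nr_ge0 // mulVf.
have [g gp] := choice step; have [b bp] := prefix_rec g.
have on n : ons (mkseq b n).
  elim: n => [|n IHn] i j; rewrite size_mkseq // !ltnS => iN jN.
  have [Lb nb] := gp _ IHn; rewrite -bp in Lb nb.
  have bn k : (k < n)%N -> dot (b n) (b k) = 0.
    by move=> kn; apply: Lb; apply/mapP; exists k; rewrite ?mem_iota.
  rewrite !nth_mkseq ?ltnS //.
  move: iN jN; rewrite leq_eqVlt => /predU1P[->|iN];
    rewrite leq_eqVlt => /predU1P[->|jN].
  - by rewrite eqxx (dotxx norm_dot) nb expr1n.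
  - by rewrite bn // gtn_eqF.
  - by rewrite (dot_eq0C (bn _ iN)) ltn_eqF.
  - by have := IHn i j; rewrite size_mkseq !nth_mkseq //; apply.
exists b => i j; have := on (maxn i j).+1 i j; rewrite size_mkseq andbT.
by rewrite !nth_mkseq ?ltnS ?leq_maxl ?leq_maxr //; apply.
Qed.

Lemma diagonal_operator s : infinite_dimensional H -> c0star s ->
  exists X e f, compact_operator X /\ schmidt dot X s e f.
Proof.
move=> infH cs; have [b onb] := orthonormal_sequence infH.
pose e n := if 0 < s n then b n else 0.
have one : onsys dot (fun n => 0 < s n) e.
  move=> i j; rewrite /e; case: ifP => hi; last first.
    by rewrite dot0l; case: eqP => // <-; rewrite hi.
  by case: ifP => hj; rewrite ?dot0r ?andbF // onb.
have sB n := c0star_abs_le n cs.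
have [X dX] := diag_exists norm_dot one one sB.
exists X, e, e; split => //; apply: (diag_compact norm_dot one one _ _ dX).
  move=> eps eps0; have [N Np] := c0star_lt cs eps0; exists N => n /Np.
  by case: cs => s0 _ _; rewrite ger0_norm //; exact: ltW.
by exists (s 0%N).
Qed.

(** * Characteristic sets of ideals *)

Lemma char_set_c0star I s : char_set dot I s -> c0star s.
Proof. by move=> [X _ []]. Qed.

(** A diagonal operator realizes [s], and [ideal_dominated] places it in [I]. *)
Lemma char_set_solid I s z C : infinite_dimensional H -> is_ideal I ->
  char_set dot I z -> c0star s -> 0 < C -> (forall n, s n <= C * z n) ->
  char_set dot I s.
Proof.
move=> infH idI [Z IZ sZ] cs C0 sz.
have [e' [f' hZ]] := singular_numbers_schmidt (ideal_compact idI IZ) sZ.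
have [X [e [f [cX hX]]]] := diagonal_operator infH cs.
exists X; last exact: schmidt_singular_numbers hX.
exact: (ideal_dominated idI IZ hX hZ C0 sz).
Qed.

Lemma char_set_mem I X s : is_ideal I -> compact_operator X ->
  singular_numbers dot X s -> char_set dot I s -> I X.
Proof.
move=> idI cX sX [Z IZ sZ].
have [e' [f' hZ]] := singular_numbers_schmidt (ideal_compact idI IZ) sZ.
have [e [f hX]] := singular_numbers_schmidt cX sX.
by apply: (ideal_dominated idI IZ hX hZ (@ltr01 R)) => n; rewrite mul1r.
Qed.

(** Uniqueness of the singular numbers gives one direction, diagonal operators the other. *)
Lemma char_set_ideal_of (S : set (nat -> R)) s : infinite_dimensional H ->
  (forall z, S z -> c0star z) ->
  char_set dot (ideal_of_char_set dot S) s <-> S s.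
Proof.
move=> infH Sc0; split=> [[X [cX [z Sz zX]] sX]|Ss].
  by rewrite (singular_numbers_uniq sX zX).
have [X [e [f [cX hX]]]] := diagonal_operator infH (Sc0 _ Ss).
have sX := schmidt_singular_numbers hX.
by exists X => //; split => //; exists s.
Qed.

End SingularNumbers.

(** * Equality of the ideal with its am-closure *)

Local Open Scope complex_scope.
Theorem theorem8p9 (R : realType) (H : completeNormedModType R[i])
    (dot : {dot H for (@conjC R[i])})
    (norm_dot : forall x : H, `|x| ^+ 2 = dot x x)
    (separableH : separable_space H)
    (infiniteH : infinite_dimensional H)
    (I : set (H -> H)) (idealI : is_ideal I) :
  soft_edged dot I \/ soft_complemented dot I ->
  perm_invariant dot I ->
  am_closed dot I.
Proof.
move=> softI invI.
have Sc0 s : char_set dot I s -> c0star s by exact: char_set_c0star.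
have amE s : char_set dot (am_ideal dot I) s <-> am_seqs (char_set dot I) s.
  by apply: char_set_ideal_of => // z [].
apply/seteqP; split=> X.
  (* The ideal lies in its am-closure: [amean s] is dominated by itself, with [s] as witness. *)
  move=> IX; have cX := ideal_compact idealI IX; split => //.
  have [s [e [f hX]]] := schmidt_decomposition norm_dot cX.
  have cs : c0star s by case: hX.
  have sX := schmidt_singular_numbers norm_dot hX.
  exists s => //; split => //; apply/amE; split; first exact: amean_c0star.
  exists s; first by exists X.
  by exists 1 => // n; rewrite mul1r.
move=> [cX [s [cs /amE[_ [eta Seta [M M0 sM]]]] sX]].
apply: (char_set_mem norm_dot idealI cX sX).
have solid xi z C : char_set dot I z -> c0star xi -> 0 < C ->
    (forall n, xi n <= C * z n) -> char_set dot I xi.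
  by move=> Sz cxi C0 le;
    exact: (char_set_solid norm_dot infiniteH idealI Sz cxi C0).
(* Passing to [M * eta] turns the domination of the means into majorization of the partial sums. *)
have SMeta : char_set dot I (fun n => M * eta n).
  apply: (solid _ eta M) => //.
  by apply: c0starZ; [exact: ltW|exact: Sc0].
apply: (majorized_mem Sc0 solid softI invI SMeta cs) => -[|m].
  by rewrite !big_ord0.
by rewrite -mulr_sumr (sum_amean s) (sum_amean eta) [leRHS]mulrCA ler_wpM2l.
Qed.
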